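(* Let $p$ be an odd prime, $K$ a finite extension of $\mathbb{Q}_p$ with valuation ring $R$, $n\ge2$, $\mathfrak{g}=\mathfrak{sp}_{2n}(\mathbb{Z}_p)$, and let $\rho:\widehat{U(\mathfrak{g})}_K\to\widehat{A_n(R)}_K$ be the metaplectic representation. Let $\mathfrak{b}$ and $\mathfrak{c}$ be the subalgebras of $\mathfrak{g}$ of matrices $\begin{bmatrix} 0 & Y \\ 0 & 0 \end{bmatrix}$, respectively $\begin{bmatrix} 0 & 0 \\ Y & 0 \end{bmatrix}$, with $Y\in M_n(\mathbb{Z}_p)$ symmetric, and let $B=\exp(p\mathfrak{b})$, $C=\exp(p\mathfrak{c})$. Then the restrictions $\rho|_{KC}$ and $\rho|_{KB}$ are injective.
   Context: $\mathfrak{g}=\mathfrak{sp}_{2n}(\mathbb{Z}_p)=\left\{\begin{bmatrix} A & B \\ C & -A^T \end{bmatrix}:A,B,C\in M_n(\mathbb{Z}_p),\,B^T=B,\,C^T=C\right\}$. For a Lie subalgebra $\mathfrak{s}\subseteq\mathfrak{g}$ with $\mathbb{Z}_p$-basis $s_1,\dots,s_d$: the corresponding uniform pro-$p$ group is $S=\exp(p\mathfrak{s})$; $KS=RS\otimes_RK$ with $RS=\varprojlim R[S/M]$ over open normal subgroups $M$; $\widehat{U(\mathfrak{s})}_K=\widehat{U(\mathfrak{s}\otimes_{\mathbb{Z}_p}R)}\otimes_RK$ (where the hat denotes $p$-adic completion), whose elements are series $\sum_\alpha c_\alpha s_1^{\alpha_1}\cdots s_d^{\alpha_d}$ with $c_\alpha\in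 K$, $c_\alpha\to0$. $KS$ embeds in $\widehat{U(\mathfrak{s})}_K\subseteq\widehat{U(\mathfrak{g})}_K$ by sending $\exp(px)\in S$ ($x\in\mathfrak{s}$) to $e^{px}$. $A_n(R)$ is the $n$-th Weyl algebra over $R$ on $x_1,\dots,x_n,\partial_1,\dots,\partial_n$ (with $[\partial_i,x_j]=\delta_{ij}$), and $\widehat{A_n(R)}_K=\widehat{A_n(R)}\otimes_RK$ with $\widehat{A_n(R)}$ the $p$-adic completion; its elements are series $\sum_{\alpha,\beta\in\mathbb{N}_0^n}c_{\alpha,\beta}\mathbf{x}^\alpha\partial^\beta$ with $c_{\alpha,\beta}\in K$, $c_{\alpha,\beta}\to0$. The metaplectic representation $\rho$ is the continuous $K$-algebra homomorphism extending the Lie algebra homomorphism $\mathfrak{sp}_{2n}(\mathbb{Z}_p)\to A_n(\mathbb{Z}_p)$, $$\begin{bmatrix} A & B \\ C & -A^T \end{bmatrix}\longmapsto-\tfrac12\mathrm{tr}(A)-\sum_{i,j=1}^nA_{ij}x_j\partial_i+\tfrac12\sum_{i,j=1}^nB_{ij}\partial_i\partial_j-\tfrac12\sum_{i,j=1}^nC_{ij}x_ix_j.$$ *)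

(* Defs.v *)
From HB Require Import structures.
From mathcomp Require Import all_boot all_order all_algebra all_field.
From mathcomp Require Import boolp classical_sets.

Set Implicit Arguments.
Unset Strict Implicit.
Unset Printing Implicit Defensive.

Import Order.TTheory GRing.Theory Num.Theory.
Local Open Scope ring_scope.
Local Open Scope classical_set_scope.

(* A p-adic integer is the coherent sequence of its residues modulo p ^ k,
   each represented by an integer in [0, p ^ k). *)
Record Zp (p : nat) (pp : prime p) := PadicInt {
  zres : nat -> int;
  zresP : forall k, zres k = (zres k.+1 %% (p ^ k)%N%:Z)%Z
}.

Section PadicIntegers.
Variables (p : nat) (pp : prime p).
Local Notation Zp := (Zp pp).

HB.instance Definition _ := gen_eqMixin Zp.
HB.instance Definition _ := gen_choiceMixin Zp.

Local Notation q k := ((p ^ k)%N%:Z).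

Lemma zres_mod (x : Zp) k : (zres x k %% q k)%Z = zres x k.
Proof. by rewrite zresP modz_mod. Qed.

Lemma zp_eqP (x y : Zp) :
  (forall k, (zres x k = zres y k %[mod q k])%Z) -> x = y.
Proof.
case: x y => [f Hf] [g Hg] /= H.
have fg : f = g.
  by apply/funext => k; rewrite Hf Hg; have := H k.+1; have := H k;
     rewrite Hf Hg !modz_mod.
by move: Hg; rewrite -fg => Hg; rewrite (Prop_irrelevance Hf Hg).
Qed.

Definition coherent (f : nat -> int) :=
  forall k, (f k.+1 = f k %[mod q k])%Z.

Lemma q_dvdS k : (q k %| q k.+1)%Z.
Proof. by rewrite dvdzE /= dvdn_exp2l. Qed.

Lemma modz_qS a k : ((a %% q k.+1)%Z = a %[mod q k])%Z.
Proof.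
apply/eqP; rewrite eqz_mod_dvd; apply: dvdz_trans (q_dvdS k) _.
by rewrite -eqz_mod_dvd modz_mod.
Qed.

Lemma coherent_mod f : coherent f ->
  forall k, (f k %% q k)%Z = ((f k.+1 %% q k.+1)%Z %% q k)%Z.
Proof. by move=> Hf k; rewrite modz_qS Hf. Qed.

Definition zp_of f (Hf : coherent f) : Zp := @PadicInt p pp _ (coherent_mod Hf).

Lemma zres_coherent (x : Zp) : coherent (zres x).
Proof. by move=> k; rewrite -zresP zres_mod. Qed.

Lemma zp_add_subproof (x y : Zp) :
  coherent (fun k => zres x k + zres y k).
Proof.
by move=> k; rewrite -modzDm !zres_coherent modzDm.
Qed.

Lemma zp_mul_subproof (x y : Zp) :
  coherent (fun k => zres x k * zres y k).
Proof.
by move=> k; rewrite -modzMm !zres_coherent modzMm.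
Qed.

Lemma zp_opp_subproof (x : Zp) : coherent (fun k => - zres x k).
Proof. by move=> k; rewrite -modzNm zres_coherent modzNm. Qed.

Lemma zp_cst_subproof (a : int) : coherent (fun=> a).
Proof. by []. Qed.

Definition zp_add x y := zp_of (zp_add_subproof x y).
Definition zp_mul x y := zp_of (zp_mul_subproof x y).
Definition zp_opp x := zp_of (zp_opp_subproof x).
Definition zp_cst a := zp_of (zp_cst_subproof a).

Fact zp_addA : associative zp_add.
Proof.
by move=> x y z; apply: zp_eqP => k /=; rewrite !modz_mod modzDml modzDmr addrA.
Qed.
Fact zp_addC : commutative zp_add.
Proof. by move=> x y; apply: zp_eqP => k /=; rewrite addrC. Qed.
Fact zp_add0 : left_id (zp_cst 0) zp_add.
Proof. by move=> x; apply: zp_eqP => k /=; rewrite modz_mod modzDml add0r. Qed.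
Fact zp_addN : left_inverse (zp_cst 0) zp_opp zp_add.
Proof. by move=> x; apply: zp_eqP => k /=; rewrite !modz_mod modzDml addNr. Qed.
Fact zp_mulA : associative zp_mul.
Proof.
by move=> x y z; apply: zp_eqP => k /=; rewrite !modz_mod modzMml modzMmr mulrA.
Qed.
Fact zp_mulC : commutative zp_mul.
Proof. by move=> x y; apply: zp_eqP => k /=; rewrite mulrC. Qed.
Fact zp_mul1 : left_id (zp_cst 1) zp_mul.
Proof. by move=> x; apply: zp_eqP => k /=; rewrite modz_mod modzMml mul1r. Qed.
Fact zp_mulD : left_distributive zp_mul zp_add.
Proof.
by move=> x y z; apply: zp_eqP => k /=; rewrite !modz_mod modzMml modzDm mulrDl.
Qed.
Fact zp_1neq0 : zp_cst 1 != zp_cst 0.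
Proof.
apply/eqP => /(congr1 (fun x => zres x 1)) /= /eqP.
rewrite eqz_mod_dvd subr0 dvdzE /= expn1 dvdn1 => /eqP p1.
by move: pp; rewrite p1.
Qed.

HB.instance Definition _ := GRing.isZmodule.Build Zp
  zp_addA zp_addC zp_add0 zp_addN.
HB.instance Definition _ := GRing.Zmodule_isComNzRing.Build Zp
  zp_mulA zp_mulC zp_mul1 zp_mulD zp_1neq0.

Definition zp_unit : {pred Zp} := fun x => `[< exists y, y * x = 1 >].
Definition zp_inv (x : Zp) : Zp :=
  if pselect (exists y, y * x = 1) is left e then projT1 (cid e) else x.

Fact zp_mulV : {in zp_unit, left_inverse 1 zp_inv *%R}.
Proof.
by move=> x /asboolP e; rewrite /zp_inv; case: pselect => // e'; case: cid.
Qed.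
Fact zp_unitPl (x y : Zp) : y * x = 1 -> zp_unit x.
Proof. by move=> e; apply/asboolP; exists y. Qed.
Fact zp_inv_out : {in [predC zp_unit], zp_inv =1 id}.
Proof.
by move=> x; rewrite inE => /asboolP ne; rewrite /zp_inv; case: pselect.
Qed.

HB.instance Definition _ := GRing.ComNzRing_hasMulInverse.Build Zp
  zp_mulV zp_unitPl zp_inv_out.

Lemma zres_le (x : Zp) i j :
  (i <= j)%N -> (zres x j = zres x i %[mod q i])%Z.
Proof.
move=> /subnKC <-; elim: (j - i)%N => [|d IH]; first by rewrite addn0.
rewrite addnS -IH.
apply/eqP; rewrite eqz_mod_dvd.
apply: (@dvdz_trans (q (i + d))).
  by rewrite dvdzE /= dvdn_exp2l ?leq_addr.
by rewrite -eqz_mod_dvd; apply/eqP; apply: zres_coherent.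
Qed.

Lemma zp_neq0 (x : Zp) : x != 0 ->
  exists i, forall j, (i <= j)%N -> ~~ (q i %| zres x j)%Z.
Proof.
move=> x0; apply: contrapT => H; case/eqP: x0; apply: zp_eqP => i /=.
have : ~ (forall j, (i <= j)%N -> ~~ (q i %| zres x j)%Z) by move=> h; apply: H; exists i.
move=> /existsNP [j /not_implyP [ij /negP]]; rewrite negbK => h.
rewrite -(zres_le x ij) !mod0z.
by apply/dvdz_mod0P.
Qed.

Fact zp_integral (x y : Zp) : x * y = 0 -> (x == 0) || (y == 0).
Proof.
move=> xy0; rewrite -[_ || _]negbK negb_or; apply/negP => /andP[].
move=> /zp_neq0[i Hi] /zp_neq0[j Hj].
have := congr1 (fun z => zres z (i + j)) xy0; rewrite /= mod0z.
move=> /dvdz_mod0P.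
have {}Hi := Hi _ (leq_addr j i); have {}Hj := Hj _ (leq_addl i j).
move: Hi Hj; rewrite !dvdzE abszM.
move: (`|zres x _|)%N (`|zres y _|)%N => a b /= Ha Hb.
have a0 : (0 < a)%N by case: a Ha => //; rewrite dvdn0.
have b0 : (0 < b)%N by case: b Hb => //; rewrite dvdn0.
move: Ha Hb; rewrite !pfactor_dvdn ?muln_gt0 ?a0 ?b0 // lognM // -!ltnNge.
move=> Ha Hb; apply/negP; rewrite -ltnNge -addnS.
by rewrite (leq_trans _ (leq_add Ha (ltnW Hb))) // addSn -addnS leq_add2l.
Qed.

HB.instance Definition _ := GRing.ComUnitRing_isIntegral.Build Zp zp_integral.

End PadicIntegers.

Definition Qp (p : nat) (pp : prime p) : fieldType := {fraction (Zp pp)}.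

Section ValuationRing.
Variables (p : nat) (pp : prime p) (K : fieldExtType (Qp pp)).

Definition Zp_in (a : Zp pp) : K := (tofrac a : Qp pp)%:A.

(* The valuation of K over that of Q_p, written additively with integer values.
   The value at 0, which should be infinite, is unconstrained.  Any such
   function is a positive integer multiple of the normalized valuation of K. *)
Record valuation := Valuation {
  val_fun :> K -> int;
  val_mul : forall x y, x != 0 -> y != 0 ->
    val_fun (x * y) = val_fun x + val_fun y;
  val_add : forall x y, x != 0 -> y != 0 -> x + y != 0 ->
    Num.min (val_fun x) (val_fun y) <= val_fun (x + y);
  val_Zp : forall a : Zp pp, a != 0 -> 0 <= val_fun (Zp_in a);
  val_p : 0 < val_fun p%:R
}.

Variable v : valuation.

Definition in_valring : {pred K} := fun x => (x == 0) || (0 <= v x).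

Record valring := ValRing { valring_val :> K; _ : in_valring valring_val }.

HB.instance Definition _ := [isSub for valring_val].
HB.instance Definition _ := [Choice of valring by <:].

Fact val1 : v 1 = 0.
Proof.
have := val_mul v (oner_neq0 K) (oner_neq0 K).
by rewrite mulr1 => /eqP; rewrite addrC -subr_eq subrr => /eqP.
Qed.

Fact valN1 : v (-1) = 0.
Proof.
have n1 : (-1 : K) != 0 by rewrite oppr_eq0 oner_neq0.
have := val_mul v n1 n1; rewrite mulrNN mulr1 val1 => /esym/eqP.
by rewrite -mulr2n mulrn_eq0 /= => /eqP.
Qed.

Fact in_valring_subring : subring_closed in_valring.
Proof.
have mulP x y : in_valring x -> in_valring y -> in_valring (x * y).
  rewrite /in_valring mulf_eq0; case: eqVneq => //= x0; case: eqVneq => //= y0.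
  by rewrite val_mul // => ? ?; exact: addr_ge0.
have addP x y : in_valring x -> in_valring y -> in_valring (x + y).
  rewrite /in_valring; case: (eqVneq x 0) => [->|x0]; first by rewrite add0r.
  case: (eqVneq y 0) => [->|y0]; first by rewrite addr0 (negPf x0).
  case: eqVneq => //= xy0 vx vy; apply: le_trans (val_add v x0 y0 xy0).
  by rewrite le_min vx.
split=> [|x y xV yV|x y]; last exact: mulP.
  by rewrite unfold_in /in_valring val1 lexx orbT.
apply: addP => //; rewrite -mulN1r; apply: mulP => //.
by rewrite /in_valring valN1 lexx orbT.
Qed.

HB.instance Definition _ :=
  GRing.isSubringClosed.Build K in_valring in_valring_subring.
HB.instance Definition _ := [SubChoice_isSubComNzRing of valring by <:].

Fact Zp_in_valring (a : Zp pp) : in_valring (Zp_in a).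
Proof.
have [->|a0] := eqVneq a 0.
  by rewrite /in_valring /Zp_in rmorph0 scale0r eqxx.
by rewrite /in_valring val_Zp ?orbT.
Qed.

Definition Zp_valring (a : Zp pp) : valring := ValRing (Zp_in_valring a).

End ValuationRing.

(* An R-algebra given by a carrier with operations that satisfy the axioms up to
   an equivalence relation; its elements are those of the quotient [quot] below.
   The library's algType is not used because it requires 1 != 0, which an algebra
   given by a presentation does not provide by construction. *)
Record setoid_alg (R : comPzRingType) := SetoidAlg {
  sa_car : Type;
  sa_eqv : sa_car -> sa_car -> Prop;
  sa_add : sa_car -> sa_car -> sa_car;
  sa_mul : sa_car -> sa_car -> sa_car;
  sa_cst : R -> sa_car;
  sa_refl : forall x, sa_eqv x x;
  sa_sym : forall x y, sa_eqv x y -> sa_eqv y x;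
  sa_trans : forall x y z, sa_eqv x y -> sa_eqv y z -> sa_eqv x z;
  sa_addE : forall x x' y y',
    sa_eqv x x' -> sa_eqv y y' -> sa_eqv (sa_add x y) (sa_add x' y');
  sa_mulE : forall x x' y y',
    sa_eqv x x' -> sa_eqv y y' -> sa_eqv (sa_mul x y) (sa_mul x' y');
  sa_addA : forall x y z,
    sa_eqv (sa_add x (sa_add y z)) (sa_add (sa_add x y) z);
  sa_addC : forall x y, sa_eqv (sa_add x y) (sa_add y x);
  sa_add0 : forall x, sa_eqv (sa_add (sa_cst 0) x) x;
  sa_mulA : forall x y z,
    sa_eqv (sa_mul x (sa_mul y z)) (sa_mul (sa_mul x y) z);
  sa_mul1 : forall x, sa_eqv (sa_mul (sa_cst 1) x) x;
  sa_mul0 : forall x, sa_eqv (sa_mul (sa_cst 0) x) (sa_cst 0);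
  sa_mulDl : forall x y z,
    sa_eqv (sa_mul (sa_add x y) z) (sa_add (sa_mul x z) (sa_mul y z));
  sa_mulDr : forall x y z,
    sa_eqv (sa_mul x (sa_add y z)) (sa_add (sa_mul x y) (sa_mul x z));
  sa_cstD : forall a b, sa_eqv (sa_cst (a + b)) (sa_add (sa_cst a) (sa_cst b));
  sa_cstM : forall a b, sa_eqv (sa_cst (a * b)) (sa_mul (sa_cst a) (sa_cst b));
  sa_cstC : forall a x, sa_eqv (sa_mul (sa_cst a) x) (sa_mul x (sa_cst a))
}.

Section Quotient.
Variables (R : comPzRingType) (S : setoid_alg R).
Local Notation car := (sa_car S).

Record quot := Quot { qset : set car; _ : exists x, qset = sa_eqv x }.

HB.instance Definition _ := gen_eqMixin quot.
HB.instance Definition _ := gen_choiceMixin quot.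

Definition cls (x : car) : quot :=
  @Quot (sa_eqv x) (ex_intro _ x erefl).

Lemma qset_inj X Y : qset X = qset Y -> X = Y.
Proof.
case: X Y => [X eX] [Y eY] /= XY; move: eY; rewrite -XY => eY.
by rewrite (Prop_irrelevance eX eY).
Qed.

Lemma cls_eq (x y : car) : cls x = cls y <-> sa_eqv x y.
Proof.
split=> [/(congr1 qset) /= ->|xy]; first exact: sa_refl.
apply/qset_inj/funext => z; apply/propext; split; apply: sa_trans => //.
exact: sa_sym.
Qed.

Lemma cls_surj (X : quot) : exists x, X = cls x.
Proof. by case: X => X [x eX]; exists x; exact: qset_inj. Qed.

Definition qrepr (X : quot) : car := projT1 (cid (cls_surj X)).
Lemma qreprK X : cls (qrepr X) = X.
Proof. by rewrite /qrepr; case: cid. Qed.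

Definition q_add X Y := cls (sa_add (qrepr X) (qrepr Y)).
Definition q_mul X Y := cls (sa_mul (qrepr X) (qrepr Y)).
Definition q_cst a := cls (sa_cst S a).
Definition q_opp X := q_mul (q_cst (-1)) X.
Definition q_scale a X := q_mul (q_cst a) X.

Lemma q_addE x y : q_add (cls x) (cls y) = cls (sa_add x y).
Proof. by apply/cls_eq; apply: sa_addE; apply/cls_eq; rewrite qreprK. Qed.
Lemma q_mulE x y : q_mul (cls x) (cls y) = cls (sa_mul x y).
Proof. by apply/cls_eq; apply: sa_mulE; apply/cls_eq; rewrite qreprK. Qed.

Local Ltac lift2 :=
  repeat (let X := fresh in let x := fresh in
          intro X; destruct (cls_surj X) as [x ->]);
  rewrite /q_cst ?(q_addE, q_mulE); apply/cls_eq.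

Fact q_addA : associative q_add.
Proof. lift2; exact: sa_addA. Qed.
Fact q_addC : commutative q_add.
Proof. lift2; exact: sa_addC. Qed.
Fact q_add0 : left_id (q_cst 0) q_add.
Proof. lift2; exact: sa_add0. Qed.
Fact q_mulA : associative q_mul.
Proof. lift2; exact: sa_mulA. Qed.
Fact q_mul1 : left_id (q_cst 1) q_mul.
Proof. lift2; exact: sa_mul1. Qed.
Fact q_cstC a X : q_mul (q_cst a) X = q_mul X (q_cst a).
Proof. move: X; lift2; exact: sa_cstC. Qed.
Fact q_mulr1 : right_id (q_cst 1) q_mul.
Proof. by move=> X; rewrite -q_cstC q_mul1. Qed.
Fact q_mulDl : left_distributive q_mul q_add.
Proof. lift2; exact: sa_mulDl. Qed.
Fact q_mulDr : right_distributive q_mul q_add.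
Proof. lift2; exact: sa_mulDr. Qed.
Fact q_cstD a b : q_cst (a + b) = q_add (q_cst a) (q_cst b).
Proof. by rewrite q_addE; apply/cls_eq; exact: sa_cstD. Qed.
Fact q_cstM a b : q_cst (a * b) = q_mul (q_cst a) (q_cst b).
Proof. by rewrite q_mulE; apply/cls_eq; exact: sa_cstM. Qed.
Fact q_mul0 X : q_mul (q_cst 0) X = q_cst 0.
Proof. move: X; lift2; exact: sa_mul0. Qed.
Fact q_addN : left_inverse (q_cst 0) q_opp q_add.
Proof.
by move=> X; rewrite /q_opp -[X in q_add _ X]q_mul1 -q_mulDl -q_cstD addNr q_mul0.
Qed.

HB.instance Definition _ := GRing.isZmodule.Build quot
  q_addA q_addC q_add0 q_addN.
HB.instance Definition _ := GRing.Zmodule_isPzRing.Build quot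
  q_mulA q_mul1 q_mulr1 q_mulDl q_mulDr.

Fact q_scaleA a b X : q_scale a (q_scale b X) = q_scale (a * b) X.
Proof. by rewrite /q_scale q_mulA q_cstM. Qed.
Fact q_scaleDr : right_distributive q_scale +%R.
Proof. by move=> a X Y; exact: q_mulDr. Qed.
Fact q_scaleDl X : {morph q_scale^~ X : a b / a + b}.
Proof. by move=> a b; rewrite /q_scale q_cstD q_mulDl. Qed.

HB.instance Definition _ := GRing.Zmodule_isLmodule.Build R quot
  q_scaleA q_mul1 q_scaleDr q_scaleDl.

Fact q_scaleAl (a : R) (X Y : quot) : a *: (X * Y) = (a *: X) * Y.
Proof. exact: q_mulA. Qed.
Fact q_scaleAr (a : R) (X Y : quot) : a *: (X * Y) = X * (a *: Y).
Proof. 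
rewrite q_scaleAl; have -> : a *: X = X * q_cst a by exact: q_cstC.
by rewrite -mulrA. Qed.

End Quotient.

Coercion quot : setoid_alg >-> Sortclass.

(* The R-algebra with generators G and relations rel: terms modulo the least
   congruence that contains rel and satisfies the axioms of R-algebras. *)
Section Presentation.
Variables (R : comPzRingType) (G : Type).

Inductive term :=
| Gen of G
| Cst of R
| Add of term & term
| Mul of term & term.

Variable rel : term -> term -> Prop.

Inductive cong : term -> term -> Prop :=
| cong_rel s t : rel s t -> cong s t
| cong_refl s : cong s s
| cong_sym s t : cong s t -> cong t s
| cong_trans s t u : cong s t -> cong t u -> cong s u
| cong_addE s s' t t' : cong s s' -> cong t t' -> cong (Add s t) (Add s' t')
| cong_mulE s s' t t' : cong s s' -> cong t t' -> cong (Mul s t) (Mul s' t')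
| cong_addA s t u : cong (Add s (Add t u)) (Add (Add s t) u)
| cong_addC s t : cong (Add s t) (Add t s)
| cong_add0 s : cong (Add (Cst 0) s) s
| cong_mulA s t u : cong (Mul s (Mul t u)) (Mul (Mul s t) u)
| cong_mul1 s : cong (Mul (Cst 1) s) s
| cong_mul0 s : cong (Mul (Cst 0) s) (Cst 0)
| cong_mulDl s t u : cong (Mul (Add s t) u) (Add (Mul s u) (Mul t u))
| cong_mulDr s t u : cong (Mul s (Add t u)) (Add (Mul s t) (Mul s u))
| cong_cstD a b : cong (Cst (a + b)) (Add (Cst a) (Cst b))
| cong_cstM a b : cong (Cst (a * b)) (Mul (Cst a) (Cst b))
| cong_cstC a s : cong (Mul (Cst a) s) (Mul s (Cst a)).

Definition presented : setoid_alg R :=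
  SetoidAlg cong_refl cong_sym cong_trans cong_addE cong_mulE cong_addA
    cong_addC cong_add0 cong_mulA cong_mul1 cong_mul0 cong_mulDl cong_mulDr
    cong_cstD cong_cstM cong_cstC.

Definition pgen (g : G) : presented := cls (S := presented) (Gen g).

End Presentation.

Arguments Gen {R G}.
Arguments Cst {R G}.

(* The base change of an R-algebra A along phi : R -> K, presented as the
   K-algebra generated by symbols [a] = a (x) 1 that are additive and
   multiplicative in a and satisfy [r 1] = phi r. *)
Section BaseChange.
Variables (R K : comPzRingType) (phi : R -> K) (A : setoid_alg R).

Inductive base_change_rel : term K A -> term K A -> Prop :=
| bc_add (a b : A) : base_change_rel (Gen (a + b)) (Add (Gen a) (Gen b))
| bc_mul (a b : A) : base_change_rel (Gen (a * b)) (Mul (Gen a) (Gen b))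
| bc_cst (r : R) : base_change_rel (Gen (r *: (1 : A))) (Cst (phi r)).

Definition base_change : setoid_alg K := presented base_change_rel.

Definition to_base_change (a : A) : base_change := pgen base_change_rel a.

End BaseChange.

Inductive two_sided_ideal (A : pzRingType) (X : set A) : set A :=
| ideal0 : two_sided_ideal X 0
| ideal_gen x : X x -> two_sided_ideal X x
| ideal_add x y : two_sided_ideal X x -> two_sided_ideal X y ->
    two_sided_ideal X (x + y)
| ideal_mull a x : two_sided_ideal X x -> two_sided_ideal X (a * x)
| ideal_mulr a x : two_sided_ideal X x -> two_sided_ideal X (x * a).

(* The inverse limit of the quotients A / I_i by the two-sided ideals I_i
   generated by X i, ordered by inclusion: families (f i) in A, each f i taken
   modulo I_i, such that f j = f i modulo I_i whenever I_j is contained in I_i. *)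
Section InverseLimit.
Variables (R : comPzRingType) (A : setoid_alg R) (I : Type) (X : I -> set A).

Definition idl (i : I) : set A := two_sided_ideal (X i).

Record family := Family {
  fam :> I -> A;
  famP : forall i j, idl j `<=` idl i -> idl i (fam i - fam j)
}.

Definition family_eqv (f g : family) := forall i, idl i (f i - g i).

Lemma idlN i x : idl i x -> idl i (- x).
Proof. by move=> h; rewrite -mulN1r; apply: ideal_mull. Qed.

Lemma idl_addE i x x' y y' :
  idl i (x - x') -> idl i (y - y') -> idl i (x + y - (x' + y')).
Proof. by move=> hx hy; rewrite opprD addrACA; apply: ideal_add. Qed.

Lemma idl_mulE i x x' y y' :
  idl i (x - x') -> idl i (y - y') -> idl i (x * y - x' * y').
Proof.
move=> hx hy.
have -> : x * y - x' * y' = (x - x') * y + x' * (y - y').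
  by rewrite mulrBl mulrBr addrA subrK.
by apply: ideal_add; [apply: ideal_mulr | apply: ideal_mull].
Qed.

Lemma idl_eq i x y : x = y -> idl i (x - y).
Proof. by move=> ->; rewrite subrr; apply: ideal0. Qed.

Definition family_add (f g : family) : family :=
  @Family (fun i => f i + g i)
    (fun i j ij => idl_addE (famP f ij) (famP g ij)).
Definition family_mul (f g : family) : family :=
  @Family (fun i => f i * g i)
    (fun i j ij => idl_mulE (famP f ij) (famP g ij)).
Definition family_diag (a : A) : family :=
  @Family (fun=> a) (fun i j _ => idl_eq i (erefl a)).
Definition family_cst (r : R) : family := family_diag (r *: (1 : A)).

Definition inverse_limit : setoid_alg R.
Proof.
apply: (@SetoidAlg R family family_eqv family_add family_mul family_cst).
- by move=> f i; apply: idl_eq.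
- by move=> f g fg i; rewrite -opprB; apply: idlN.
- move=> f g h fg gh i; have := ideal_add (fg i) (gh i).
  by rewrite addrA subrK.
- by move=> f f' g g' hf hg i; apply: idl_addE.
- by move=> f f' g g' hf hg i; apply: idl_mulE.
- by move=> f g h i; apply: idl_eq; rewrite /= addrA.
- by move=> f g i; apply: idl_eq; rewrite /= addrC.
- by move=> f i; apply: idl_eq; rewrite /= scale0r add0r.
- by move=> f g h i; apply: idl_eq; rewrite /= mulrA.
- by move=> f i; apply: idl_eq; rewrite /= scale1r mul1r.
- by move=> f i; apply: idl_eq; rewrite /= scale0r mul0r.
- by move=> f g h i; apply: idl_eq; rewrite /= mulrDl.
- by move=> f g h i; apply: idl_eq; rewrite /= mulrDr.
- by move=> a b i; apply: idl_eq; rewrite /= scalerDl.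
- by move=> a b i; apply: idl_eq; rewrite /= -q_scaleAl mul1r scalerA.
- by move=> a f i; apply: idl_eq; rewrite /= -q_scaleAl mul1r -q_scaleAr mulr1.
Defined.

Definition to_limit (a : A) : inverse_limit :=
  cls (S := inverse_limit) (family_diag a).

End InverseLimit.

Section CompletedAlgebras.
Variables (p : nat) (pp : prime p) (K : fieldExtType (Qp pp)) (v : valuation K).
Local Notation R := (valring v).

Definition padic_completion (A : setoid_alg R) : setoid_alg R :=
  inverse_limit (fun k : nat => [set (p ^ k)%:R : A]).

Definition completion_K (A : setoid_alg R) : setoid_alg K :=
  base_change (@valring_val _ _ _ v) (padic_completion A).

Definition to_completion_K (A : setoid_alg R) (a : A) : completion_K A :=
  to_base_change _ (to_limit _ a : padic_completion A).

(* p ^ k times the unit ball, that is, the image of the completion of A. *)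
Definition padic_ball (A : setoid_alg R) (k : nat) : set (completion_K A) :=
  [set z | exists a : padic_completion A,
             z = (p ^ k)%:R *: to_base_change (@valring_val _ _ _ v) a].

Definition padic_continuous (A B : setoid_alg R)
    (f : completion_K A -> completion_K B) :=
  forall k, exists l, forall z w,
    padic_ball l (z - w) -> padic_ball k (f z - f w).

(* z is the sum of the exponential series of y. *)
Definition is_exp (A : setoid_alg R) (y z : completion_K A) :=
  forall k, exists N0, forall N, (N0 <= N)%N ->
    padic_ball k (\sum_(i < N) ((i`!)%:R : K)^-1 *: y ^+ i - z).

(* inl i and inr i are the generators x_i and d_i. *)
Section Weyl.
Variable n : nat.
Local Notation x i := (Gen (inl i)).
Local Notation d i := (Gen (inr i)).

Inductive weyl_rel :
    term R ('I_n + 'I_n) -> term R ('I_n + 'I_n) -> Prop :=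
| weyl_xx i j : weyl_rel (Mul (x i) (x j)) (Mul (x j) (x i))
| weyl_dd i j : weyl_rel (Mul (d i) (d j)) (Mul (d j) (d i))
| weyl_dx i j :
    weyl_rel (Mul (d i) (x j)) (Add (Mul (x j) (d i)) (Cst (i == j)%:R)).

Definition weyl : setoid_alg R := presented weyl_rel.
Definition weyl_x (i : 'I_n) : completion_K weyl :=
  to_completion_K (pgen weyl_rel (inl i)).
Definition weyl_d (i : 'I_n) : completion_K weyl :=
  to_completion_K (pgen weyl_rel (inr i)).

End Weyl.

Section Enveloping.
Variables (m : nat) (s : set 'M[Zp pp]_m).

(* U(s (x) R) = U(s) (x) R, presented over R by the Z_p-Lie algebra s. *)
Inductive env_rel : term R {X | s X} -> term R {X | s X} -> Prop :=
| env_add X Y Z : sval Z = sval X + sval Y ->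
    env_rel (Gen Z) (Add (Gen X) (Gen Y))
| env_scale a X Y : sval Y = a *: sval X ->
    env_rel (Gen Y) (Mul (Cst (Zp_valring v a)) (Gen X))
| env_lie X Y Z : sval Z = sval X *m sval Y - sval Y *m sval X ->
    env_rel (Add (Gen Z) (Mul (Gen Y) (Gen X))) (Mul (Gen X) (Gen Y)).

Definition enveloping : setoid_alg R := presented env_rel.
Definition env_in (X : {X | s X}) : completion_K enveloping :=
  to_completion_K (pgen env_rel X).

End Enveloping.

Definition mx_Qp m (x : 'M[Zp pp]_m) : 'M[Qp pp]_m :=
  map_mx (@tofrac (Zp pp)) x.

Definition is_expm m (x g : 'M[Zp pp]_m) :=
  forall k, exists N0, forall N, (N0 <= N)%N -> exists a : 'M[Zp pp]_m,
    \sum_(i < N) ((i`!)%:R : Qp pp)^-1 *: mx_Qp x ^+ i - mx_Qp g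
      = (p ^ k)%:R *: mx_Qp a.

Definition exp_group m (s : set 'M[Zp pp]_m) : set 'M[Zp pp]_m :=
  [set g | exists2 x, s x & is_expm (p%:R *: x) g].

Section GroupAlgebra.
Variables (m : nat) (S : set 'M[Zp pp]_m).

Record open_normal (M : set 'M[Zp pp]_m) : Prop := OpenNormal {
  on_sub : M `<=` S;
  on_1 : M 1%:M;
  on_mul : forall g h, M g -> M h -> M (g *m h);
  on_inv : forall g h, M g -> S h -> g *m h = 1%:M -> M h;
  on_conj : forall g h k, S g -> S h -> g *m h = 1%:M -> M k ->
    M (g *m k *m h);
  on_open : exists l, forall g, S g ->
    (exists a, g = 1%:M + (p ^ l)%:R *: a) -> M g
}.

(* R[S] is presented by the elements of S, with the products taken in S. *)
Inductive group_rel : term R {g | S g} -> term R {g | S g} -> Prop :=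
| group_1 g : sval g = 1%:M -> group_rel (Gen g) (Cst 1)
| group_mul g h k : sval k = sval g *m sval h ->
    group_rel (Gen k) (Mul (Gen g) (Gen h)).

Definition group_alg : setoid_alg R := presented group_rel.
Definition group_in (g : {g | S g}) : group_alg := pgen group_rel g.

(* Generators of the kernel of R[S] -> R[S/M]. *)
Definition augmentation (M : {M | open_normal M}) : set group_alg :=
  [set x | exists2 g, sval M (sval g) & x = group_in g - 1].

(* RS, the inverse limit of the R[S/M] = R[S] / (g - 1 | g in M), and KS. *)
Definition iwasawa_R : setoid_alg R := inverse_limit augmentation.
Definition iwasawa_K : setoid_alg K :=
  base_change (@valring_val _ _ _ v) iwasawa_R.

Definition iwasawa_in (g : {g | S g}) : iwasawa_K :=
  to_base_change _ (to_limit augmentation (group_in g) : iwasawa_R).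

(* The elements of RS whose component in R[S/M] lies in p ^ l R[S/M]; these form
   a basis of neighbourhoods of 0. *)
Definition iwasawa_nbhs (M : {M | open_normal M}) (l : nat) : set iwasawa_R :=
  [set mu | exists f : family augmentation,
     mu = cls (S := inverse_limit augmentation) f /\
     exists a : group_alg, idl augmentation M (f M - (p ^ l)%:R *: a)].

End GroupAlgebra.

Section Metaplectic.
Variable n : nat.

Definition sp : set 'M[Zp pp]_(n + n) :=
  [set X | exists A B C, [/\ B^T = B, C^T = C & X = block_mx A B C (- A^T)]].

Definition sp_b : set 'M[Zp pp]_(n + n) :=
  [set X | exists2 Y, Y^T = Y & X = block_mx 0 Y 0 0].

Definition sp_c : set 'M[Zp pp]_(n + n) :=
  [set X | exists2 Y, Y^T = Y & X = block_mx 0 0 Y 0].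

Local Notation U_K := (completion_K (enveloping sp)).
Local Notation A_K := (completion_K (weyl n)).
Local Notation x := (@weyl_x n).
Local Notation d := (@weyl_d n).
Local Notation "a %:K" := (Zp_in K a) (at level 2, format "a %:K").

Record is_metaplectic (rho : {rmorphism U_K -> A_K}) : Prop := {
  metaplectic_scalable : scalable rho;
  metaplectic_continuous : padic_continuous rho;
  metaplecticE : forall (X : {X | sp X}) (A B C : 'M[Zp pp]_n),
    sval X = block_mx A B C (- A^T) ->
    rho (env_in X) =
      - ((2%:R^-1 * (\tr A)%:K) *: (1 : A_K))
      - \sum_(i < n) \sum_(j < n) (A i j)%:K *: (x j * d i)
      + 2%:R^-1 *: (\sum_(i < n) \sum_(j < n) (B i j)%:K *: (d i * d j))
      - 2%:R^-1 *: (\sum_(i < n) \sum_(j < n) (C i j)%:K *: (x i * x j))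
}.

(* The embedding of KS, S = exp(p s), as the continuous homomorphism of
   K-algebras that sends exp(p X) to e ^ (p X) for X in s. *)
Record is_iwasawa_embedding (s : set 'M[Zp pp]_(n + n))
    (iota : {rmorphism iwasawa_K (exp_group s) -> U_K}) : Prop := {
  iwasawa_scalable : scalable iota;
  iwasawa_continuous : forall k, exists M l,
    forall mu : iwasawa_R (exp_group s), iwasawa_nbhs M l mu ->
      padic_ball k (iota (to_base_change _ mu));
  iwasawa_exp : forall (X : {X | sp X}) (g : {g | exp_group s g}),
    s (sval X) -> is_expm (p%:R *: sval X) (sval g) ->
    is_exp (p%:R *: env_in X) (iota (iwasawa_in g))
}.

End Metaplectic.
End CompletedAlgebras.

(* Main.v *)
From HB Require Import structures.
Require Import Defs.
From mathcomp Require Import all_boot all_order all_algebra all_field.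
From mathcomp Require Import cyclic.
From mathcomp Require Import boolp classical_sets functions.
From mathcomp Require Import mpoly ring.

Set Implicit Arguments.
Unset Strict Implicit.
Unset Printing Implicit Defensive.

Import Order.TTheory GRing.Theory Num.Theory.
Local Open Scope ring_scope.

(** An element [mu] of [RS], for [S = exp (p s)] with [s] one of the two abelian
    algebras, is an [R]-valued measure on the lattice of symmetric matrices [Y],
    the group element [exp (p X_Y) = 1 + p X_Y] being the point [Y].  The composite
    of the embedding and of [rho] sends it to the integral of
    [exp (c (p Y) [x])] against [mu], where [Y [x]] is the quadratic form of [Y] in
    the commuting variables [x_i] (or [d_i]) and [c] is [-1/2] (or [1/2]).  If
    this vanishes, then so does every moment, the integral of [Y [x] ^ i], as a
    polynomial in [x].

    The products [x_i x_j] are algebraically dependent, so the moments do not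
    contain the integrals of all polynomials in [Y].  Yet they determine [mu].
    Substitute [x_a = theta ^ (2 ^ a)], where [theta ^ N = p] and [N > 2 ^ n].  As
    the sums [2 ^ a + 2 ^ b] are distinct, the map [w : Y -> Y [x]] is injective
    into the discrete valuation ring [Z_p[theta]], and if the images of two
    matrices are congruent modulo [p ^ m], then so are the matrices
    ([form_at_powers_dvd]).  By Kaplansky's form of the Stone-Weierstrass theorem,
    the indicator function of a coset of an ideal of [Z_p[theta]] is a uniform limit
    of polynomials over the fraction field ([indicator_approx]).  Integrating these
    polynomials in [w (Y)] against [mu] expresses the mass of every coset by the
    moments, so all the masses are [0], and [mu = 0].

    The algebras are given by presentations and completions, so three more facts
    carry the argument.  A presented algebra is studied through its actions: on
    functions of [Y] by translation, which recovers the mass of a coset from an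
    element of the group algebra ([coset_mass_congr], [zero_masses_ideal]), and on
    polynomials, for the Weyl algebra.  The latter action extends to the
    completion with [p] inverted on bounded sequences of polynomials modulo null
    sequences, and shows that a polynomial in the [x_i] (or the [d_i]) that lies in
    [p ^ k] times the unit ball has coefficients divisible by [p ^ k]
    ([acts_by_ball]).  Finally, by continuity [mu] may be replaced by finite
    combinations of group elements whose images are as small as desired
    ([approximation]); the moments of these are then small rather than [0], which is
    why the moment argument is carried out to finite precision ([moments_mass]). *)

(** * p-adic integers *)

Section PadicIntegers.
Variables (p : nat) (pp : prime p).
Local Notation Zp := (Defs.Zp pp).

Lemma zres_nat (a : nat) k : zres (a%:R : Zp) k = (a%:Z %% (p ^ k)%N%:Z)%Z.
Proof.
elim: a => [|a IH]; first by rewrite mulr0n /=.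
by rewrite -addn1 natrD /= IH modzDm PoszD.
Qed.

Lemma zp_dvd (x : Zp) k : zres x k = 0 -> exists y, x = (p ^ k)%:R * y.
Proof.
move=> xk0.
have q0 j : (p ^ j)%N%:Z != 0 by rewrite eqz_nat -lt0n expn_gt0 prime_gt0.
have dv j : ((p ^ k)%N%:Z %| zres x (j + k))%Z.
  by apply/dvdz_mod0P; rewrite (zres_le x (leq_addl j k)) xk0 mod0z.
have coh : @coherent p (fun j => (zres x (j + k) %/ (p ^ k)%N%:Z)%Z).
  move=> j; apply/eqP; rewrite eqz_mod_dvd -(@dvdz_mul2r (p ^ k)%N%:Z) //.
  rewrite mulrBl !divzK // -PoszM -expnD -eqz_mod_dvd addSn.
  by apply/eqP; exact: zres_coherent.
exists (zp_of pp coh); apply: zp_eqP => j.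
have -> : zres ((p ^ k)%:R * zp_of pp coh) j =
          ((p ^ k)%N%:Z * (zres x (j + k) %/ (p ^ k)%N%:Z)%Z %% (p ^ j)%N%:Z)%Z.
  by rewrite /= zres_nat modzMml modzMmr.
by rewrite mulrC divzK // modz_mod (zres_le x (leq_addr k j)).
Qed.

Lemma zp_cancel_coprime (a m : nat) (x : Zp) : coprime p a ->
  (exists y, a%:R * x = (p ^ m)%:R * y) -> exists y, x = (p ^ m)%:R * y.
Proof.
move=> cpa [y e]; apply: zp_dvd.
have := congr1 (fun z => zres z m) e; rewrite /= !zres_nat modzMml modzz mul0r mod0z.
move/dvdz_mod0P; rewrite Gauss_dvdzr; last by have := coprimeXl m cpa;
  rewrite /coprime /coprimez /gcdz => /eqP ->.
by move=> h; rewrite -zres_mod; apply/dvdz_mod0P.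
Qed.

Lemma zp_nat_neq0 (a : nat) : (0 < a)%N -> (a%:R : Zp) != 0.
Proof.
move=> a0; apply/eqP => /(congr1 (fun z => zres z a)); rewrite zres_nat /= mod0z.
rewrite modz_nat modn_small => [[e]|]; first by rewrite e in a0.
by rewrite ltn_expl // prime_gt1.
Qed.

(** Fermat's theorem in the residue field [F_p], lifted to [Z_p]. *)
Lemma zp_residue (x : Zp) :
  (exists y, x = p%:R * y) \/ (exists y, x ^+ p.-1 = 1 + p%:R * y).
Proof.
have [x0|x0] := eqVneq (zres x 1) 0.
  by left; have := zp_dvd x0; rewrite expn1.
right; have [a xa] : exists a : nat, exists y, x = a%:R + p%:R * y.
  have p0 : (p ^ 1)%N%:Z != 0 by rewrite expn1 eqz_nat -lt0n prime_gt0.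
  exists `|zres x 1|%N.
  have : exists y, x - `|zres x 1|%:R = (p ^ 1)%:R * y.
    apply: zp_dvd; rewrite /= zres_nat modzNm modzDmr.
    have -> : `|zres x 1|%N%:Z = zres x 1.
      by apply: gez0_abs; rewrite -zres_mod modz_ge0.
    by rewrite subrr mod0z.
  by rewrite expn1 => -[y e]; exists y; rewrite -e addrC subrK.
case: xa => y xa.
have cop : coprime a p.
  rewrite coprime_sym prime_coprime //; apply: contra x0 => /dvdnP[c ac].
  rewrite xa ac natrM mulrC -mulrDr /= zres_nat expn1 modzMml.
  by rewrite modzMr.
have [c ec] : exists c : nat, (a ^ p.-1 = c * p + 1)%N.
  have := Euler_exp_totient cop; rewrite totient_prime // (modn_small (prime_gt1 pp)).
  by move=> e; exists (a ^ p.-1 %/ p)%N; rewrite {1}(divn_eq (a ^ p.-1) p) e.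
have [d ed] : exists d, x ^+ p.-1 - a%:R ^+ p.-1 = (x - a%:R) * d.
  by rewrite subrXX; eexists; reflexivity.
exists (c%:R + y * d).
rewrite -[LHS](subrK (a%:R ^+ p.-1)) ed {1}xa [a%:R + _]addrC addrK.
by rewrite -natrX ec natrD natrM; ring.
Qed.

End PadicIntegers.

(** * Divisibility modulo a monic polynomial *)

Section LowDegree.

(** Division by a monic polynomial is possible over any ring: a polynomial of
    small degree that is divisible by [b] modulo ['X^N - a] is divisible by [b],
    even if the second cofactor has coefficients in a larger ring. *)
Lemma low_degree_dvd (A B : comNzRingType) (f : {rmorphism A -> B}) (a : A)
    (b : B) N (w h : {poly B}) (g : {poly A}) : (0 < N)%N -> (size w <= N)%N ->
  w = b *: map_poly f g + ('X^N - (f a)%:P) * h ->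
  exists r, w = b *: map_poly f r.
Proof.
move=> N0 sw ew; pose q := 'X^N - a%:P : {poly A}.
have qm : q \is monic := monicXnsubC a N0.
have sq : size q = N.+1 by rewrite size_XnsubC.
have fq : map_poly f q = 'X^N - (f a)%:P.
  by rewrite rmorphB /= map_polyXn map_polyC.
have fqm : map_poly f q \is monic by rewrite fq monicXnsubC.
exists (Pdiv.Ring.rmodp g q); set r := Pdiv.Ring.rmodp g q.
have sr : (size r <= N)%N.
  by rewrite -ltnS -sq Pdiv.Ring.ltn_rmodpN0 ?monic_neq0.
pose h' := b *: map_poly f (Pdiv.Ring.rdivp g q) + h.
have e : w - b *: map_poly f r = map_poly f q * h'.
  rewrite ew {1}(Pdiv.RingMonic.rdivp_eq qm g) rmorphD rmorphM /= -/r /h' fq.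
  by rewrite -!mul_polyC; ring.
have [h0|h0] := eqVneq h' 0; first by apply/eqP; rewrite -subr_eq0 e h0 mulr0.
have : (size (w - b *: map_poly f r)%R <= N)%N.
  rewrite (leq_trans (size_polyD _ _)) // geq_max sw size_polyN.
  by rewrite (leq_trans (size_scale_leq _ _)) // (leq_trans (size_poly _ _)).
rewrite e size_monicM // fq size_XnsubC // addSn /=.
by rewrite leqNgt -[X in (X < _)%N]addn0 ltn_add2l lt0n size_poly_eq0 h0.
Qed.

End LowDegree.

(** * Divisibility by powers of p in the field K *)

Section Integrality.
Variables (p : nat) (pp : prime p) (K : fieldExtType (Qp pp)) (v : valuation K).
Local Notation Zp := (Defs.Zp pp).
Local Notation R := (valring v).

Definition zpR (a : Zp) : R := Zp_valring v a.
(** A copy of the coercion that carries the structure of a ring morphism. *)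
Definition valK (r : R) : K := valring_val r.
Arguments valK : simpl never.

Fact Zp_in_zmod_morphism : zmod_morphism (@Zp_in p pp K).
Proof. by move=> a b; rewrite /Zp_in rmorphB scalerBl. Qed.
Fact Zp_in_monoid_morphism : monoid_morphism (@Zp_in p pp K).
Proof.
by split=> [|a b]; rewrite /Zp_in ?rmorph1 ?scale1r // rmorphM -scalerAl mul1r scalerA.
Qed.
HB.instance Definition _ :=
  GRing.isZmodMorphism.Build Zp K (@Zp_in p pp K) Zp_in_zmod_morphism.
HB.instance Definition _ :=
  GRing.isMonoidMorphism.Build Zp K (@Zp_in p pp K) Zp_in_monoid_morphism.

Fact valK_zmod_morphism : zmod_morphism valK.
Proof. by []. Qed.
Fact valK_monoid_morphism : monoid_morphism valK.
Proof. by []. Qed.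
HB.instance Definition _ := GRing.isZmodMorphism.Build R K valK valK_zmod_morphism.
HB.instance Definition _ := GRing.isMonoidMorphism.Build R K valK valK_monoid_morphism.

Fact zpR_zmod_morphism : zmod_morphism zpR.
Proof. by move=> a b; apply: val_inj; exact: (rmorphB (@Zp_in p pp K)). Qed.
Fact zpR_monoid_morphism : monoid_morphism zpR.
Proof.
by split=> [|a b]; apply: val_inj;
  [exact: (rmorph1 (@Zp_in p pp K))|exact: (rmorphM (@Zp_in p pp K))].
Qed.
HB.instance Definition _ := GRing.isZmodMorphism.Build Zp R zpR zpR_zmod_morphism.
HB.instance Definition _ := GRing.isMonoidMorphism.Build Zp R zpR zpR_monoid_morphism.

Lemma Zp_in_inj : injective (@Zp_in p pp K).
Proof.
move=> a b e; have : tofrac a = tofrac b :> Qp pp.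
  by apply: (fmorph_inj (GRing.in_alg K)); exact: e.
by move/eqP; rewrite tofrac_eq => /eqP.
Qed.

Lemma natK_neq0 a : (0 < a)%N -> (a%:R : K) != 0.
Proof.
move=> a0; rewrite -(rmorph_nat (@Zp_in p pp K)) -(rmorph0 (@Zp_in p pp K)) (inj_eq
  Zp_in_inj).
exact: zp_nat_neq0.
Qed.

Lemma pX_neq0 k : ((p ^ k)%:R : K) != 0.
Proof. by rewrite natK_neq0 // expn_gt0 prime_gt0. Qed.

Lemma val_pX k : v (p ^ k)%:R = v p%:R *+ k.
Proof.
elim: k => [|k IH]; first by rewrite expn0 Defs.val1 mulr0n.
rewrite expnS natrM val_mul ?pX_neq0 ?IH ?mulrS //.
by rewrite natK_neq0 ?prime_gt0.
Qed.

Lemma val_pX_ge k : k%:Z <= v (p ^ k)%:R.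
Proof. by rewrite val_pX -[k%:Z]natz ler_wMn2r // -gtz0_ge1 val_p. Qed.

Definition pow_dvd k (c : K) := exists r : R, c = (p ^ k)%:R * valK r.

Lemma pow_dvd_val k c : c = 0 \/ v (p ^ k)%:R <= v c -> pow_dvd k c.
Proof.
case=> [->|h]; first by exists 0; rewrite rmorph0 mulr0.
have [->|c0] := eqVneq c 0; first by exists 0; rewrite rmorph0 mulr0.
have r : in_valring v ((p ^ k)%:R^-1 * c).
  rewrite /in_valring; apply/orP; right.
  have pc0 : (p ^ k)%:R^-1 * c != 0 by rewrite mulf_neq0 ?invr_eq0 ?pX_neq0.
  have := val_mul v (pX_neq0 k) pc0; rewrite mulrA mulfV ?pX_neq0 // mul1r => e.
  by rewrite e lerDl in h.
by exists (ValRing r); rewrite /= mulrA mulfV ?pX_neq0 // mul1r.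
Qed.

Lemma pow_dvd_bounded c : exists k, pow_dvd 0 ((p ^ k)%:R * c).
Proof.
have [->|c0] := eqVneq c 0.
  by exists 0%N; apply: pow_dvd_val; left; rewrite mulr0.
exists `|v c|%N; apply: pow_dvd_val; right.
rewrite expn0 Defs.val1 val_mul ?pX_neq0 // addrC -lerBlDl sub0r.
by apply: le_trans (val_pX_ge _); rewrite abszE -normrN ler_norm.
Qed.

(** The value group is archimedean, because it is [Z] and [v p > 0]. *)
Lemma pow_dvd_separated c : (forall k, pow_dvd k c) -> c = 0.
Proof.
move=> h; apply/eqP/contraT => c0.
have [r er] := h `|v c|.+1%N.
have r0 : valK r != 0 by apply: contraNneq c0 => r0; rewrite er r0 mulr0.
have vr : 0 <= v (valK r).
  case: r r0 {er} => r hr r0; case/orP: (hr) => // r00; case/negP: r0; exact: r00.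
have := val_mul v (pX_neq0 `|v c|.+1) r0; rewrite -er => e.
have := ler_wpDr vr (val_pX_ge `|v c|.+1); rewrite -e.
rewrite -addn1 PoszD abszE => le1.
by have := le_trans le1 (ler_norm _); rewrite gerDl.
Qed.

Lemma pow_dvdD k a b : pow_dvd k a -> pow_dvd k b -> pow_dvd k (a + b).
Proof. by move=> [r ->] [s ->]; exists (r + s); rewrite rmorphD mulrDr. Qed.

Lemma pow_dvdM k l a b : pow_dvd k a -> pow_dvd l b -> pow_dvd (k + l) (a * b).
Proof.
move=> [r ->] [s ->]; exists (r * s); rewrite rmorphM expnD natrM.
by rewrite mulrACA.
Qed.

Lemma pow_dvd_valK r : pow_dvd 0 (valK r).
Proof. by exists r; rewrite mul1r. Qed.

Lemma pow_dvd_pX k : pow_dvd k (p ^ k)%:R.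
Proof. by exists 1; rewrite rmorph1 mulr1. Qed.

Lemma pow_dvd0 k : pow_dvd k 0.
Proof. by exists 0; rewrite rmorph0 mulr0. Qed.

Lemma pow_dvdMl k a b : pow_dvd 0 a -> pow_dvd k b -> pow_dvd k (a * b).
Proof. exact: pow_dvdM. Qed.

Lemma pow_dvd_nat a : pow_dvd 0 a%:R.
Proof. by rewrite -(rmorph_nat valK); apply: pow_dvd_valK. Qed.

Lemma pow_dvdN k a : pow_dvd k a -> pow_dvd k (- a).
Proof. by move=> [r ->]; exists (- r); rewrite rmorphN mulrN. Qed.

Lemma pow_dvd_sum k I (s : seq I) (P : pred I) (F : I -> K) :
  (forall i, P i -> pow_dvd k (F i)) -> pow_dvd k (\sum_(i <- s | P i) F i).
Proof. by move=> h; apply: big_ind => //; [exact: pow_dvd0|exact: pow_dvdD]. Qed.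

End Integrality.

(** * Indicator functions of cosets as limits of polynomials *)

Section Kaplansky.
Variables (p : nat) (pp : prime p) (K : fieldExtType (Qp pp)) (v : valuation K).
Variables (N : nat) (N_gt0 : (0 < N)%N).
Local Notation Zp := (Defs.Zp pp).
Local Notation R := (valring v).
Local Notation eK := (map_poly (@Zp_in p pp K)).
Local Notation rK := (map_poly (@valK p pp K v)).

Definition eisenstein (A : nzRingType) : {poly A} := 'X^N - p%:R%:P.

(** The ring [K[theta]] with [theta ^ N = p] is represented by [{poly K}], with
    equality replaced by congruence modulo the Eisenstein polynomial; this is
    membership in [p ^ k] times its subring [R[theta]]. *)
Definition pow_dvd_mod k (a : {poly K}) :=
  exists (g : {poly R}) h, a = (p ^ k)%:R * rK g + eisenstein K * h.

Lemma pow_dvd_modD k a b : pow_dvd_mod k a -> pow_dvd_mod k b -> pow_dvd_mod k (a + b).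
Proof.
move=> [g [h ->]] [g' [h' ->]]; exists (g + g'), (h + h').
by rewrite rmorphD; ring.
Qed.

Lemma pow_dvd_modM k l a b : pow_dvd_mod k a -> pow_dvd_mod l b ->
  pow_dvd_mod (k + l) (a * b).
Proof.
move=> [g [h ->]] [g' [h' ->]].
exists (g * g'), (h * ((p ^ l)%:R * rK g' + eisenstein K * h') + (p ^ k)%:R * rK g * h').
by rewrite rmorphM expnD natrM; ring.
Qed.

Lemma pow_dvd_modMr k a b : pow_dvd_mod k a -> pow_dvd_mod 0 b -> pow_dvd_mod k (a * b).
Proof. by move=> ha hb; rewrite -[k]addn0; apply: pow_dvd_modM. Qed.

Lemma pow_dvd_modMl k a b : pow_dvd_mod 0 a -> pow_dvd_mod k b -> pow_dvd_mod k (a * b).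
Proof. exact: (@pow_dvd_modM 0 k). Qed.

Lemma pow_dvd_mod_rK g : pow_dvd_mod 0 (rK g).
Proof. by exists g, 0; ring. Qed.

Lemma pow_dvd_mod_eK w : pow_dvd_mod 0 (eK w).
Proof.
have -> : eK w = rK (map_poly (zpR v) w); last exact: pow_dvd_mod_rK.
by rewrite -map_poly_comp.
Qed.

Lemma pow_dvd_mod_eis k h : pow_dvd_mod k (eisenstein K * h).
Proof. by exists 0, h; rewrite rmorph0; ring. Qed.

Lemma pow_dvd_mod_pX k : pow_dvd_mod k (p ^ k)%:R.
Proof. by exists 1, 0; rewrite rmorph1; ring. Qed.

Lemma pow_dvd_mod0 k : pow_dvd_mod k 0.
Proof. by have := pow_dvd_mod_eis k 0; rewrite mulr0. Qed.

Lemma pow_dvd_modN k a : pow_dvd_mod k a -> pow_dvd_mod k (- a).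
Proof. by move=> [g [h ->]]; exists (- g), (- h); rewrite rmorphN; ring. Qed.

Lemma pow_dvd_mod_sum k I (s : seq I) (P : pred I) (F : I -> {poly K}) :
  (forall i, P i -> pow_dvd_mod k (F i)) -> pow_dvd_mod k (\sum_(i <- s | P i) F i).
Proof. by move=> h; apply: big_ind => //; [exact: pow_dvd_mod0|exact: pow_dvd_modD]. Qed.

(** Precision [d] is lost when the second factor has denominator [p ^ d]. *)
Lemma pow_dvd_mod_shift k d a b : pow_dvd_mod (k + d) a -> pow_dvd_mod 0 ((p ^ d)%:R * b) ->
  pow_dvd_mod k (a * b).
Proof.
move=> [g [h ->]] nb.
have -> : ((p ^ (k + d))%:R * rK g + eisenstein K * h) * b =
    (p ^ k)%:R * rK g * ((p ^ d)%:R * b) + eisenstein K * (h * b).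
  by rewrite expnD natrM; ring.
apply: pow_dvd_modD; last exact: pow_dvd_mod_eis.
by apply: pow_dvd_modMr nb; apply: pow_dvd_modMr (pow_dvd_mod_pX k) (pow_dvd_mod_rK g).
Qed.

Lemma pow_dvd_mod_bounded (a : {poly K}) : exists d, pow_dvd_mod 0 ((p ^ d)%:R * a).
Proof.
elim/poly_ind: a => [|a c [d IH]]; first by exists 0%N; rewrite mulr0; apply: pow_dvd_mod0.
have [d' [r er]] := pow_dvd_bounded v c.
exists (d + d')%N; rewrite expnD natrM.
have -> : (p ^ d)%:R * (p ^ d')%:R * (a * 'X + c%:P) =
    (p ^ d)%:R * a * ((p ^ d')%:R * 'X) + (p ^ d)%:R * ((p ^ d')%:R * c)%:P.
  by rewrite polyCM polyC_natr; ring.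
apply: pow_dvd_modD.
  apply: pow_dvd_modMl => //; rewrite -(map_polyX (@valK p pp K v)) -(rmorph_nat rK)
    -rmorphM.
  exact: pow_dvd_mod_rK.
by rewrite er mul1r -(map_polyC (@valK p pp K v)) -(rmorph_nat rK) -rmorphM;
  apply: pow_dvd_mod_rK.
Qed.

Lemma horner_bounded (f : {poly {poly K}}) :
  exists d, forall w, pow_dvd_mod 0 ((p ^ d)%:R * f.[eK w]).
Proof.
elim/poly_ind: f => [|f c [d IH]].
  by exists 0%N => w; rewrite horner0 mulr0; apply: pow_dvd_mod0.
have [d' hc] := pow_dvd_mod_bounded c.
exists (d + d')%N => w; rewrite hornerMXaddC expnD natrM.
have -> : (p ^ d)%:R * (p ^ d')%:R * (f.[eK w] * eK w + c) =
    (p ^ d)%:R * f.[eK w] * ((p ^ d')%:R * eK w) + (p ^ d)%:R * ((p ^ d')%:R * c).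
  by ring.
have nat0 a : pow_dvd_mod 0 a%:R by rewrite -(rmorph_nat rK); apply: pow_dvd_mod_rK.
apply: pow_dvd_modD; first exact: pow_dvd_modMl (IH w) (pow_dvd_modMl (nat0 _)
  (pow_dvd_mod_eK w)).
exact: pow_dvd_modMl (nat0 _) hc.
Qed.

Lemma horner_eis (f : {poly {poly K}}) a h :
  exists h', f.[a + eisenstein K * h] = f.[a] + eisenstein K * h'.
Proof.
elim/poly_ind: f => [|f c [h' e]]; first by exists 0; rewrite !horner0; ring.
exists (h' * a + h * (f.[a] + eisenstein K * h')).
by rewrite !hornerMXaddC e; ring.
Qed.

(** The ideal [theta ^ s] of [Z_p[theta]], in the same representation. *)
Definition theta_dvd s (w : {poly Zp}) :=
  exists g h, w = 'X^s * g + eisenstein Zp * h.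

Lemma eK_eis : eK (eisenstein Zp) = eisenstein K.
Proof.
rewrite rmorphB /= map_polyXn map_polyC /eisenstein; congr (_ - _%:P).
exact: (rmorph_nat (@Zp_in p pp K)).
Qed.

Lemma theta_dvd0 s : theta_dvd s 0. Proof. by exists 0, 0; ring. Qed.

Lemma theta_dvdD s a b : theta_dvd s a -> theta_dvd s b -> theta_dvd s (a + b).
Proof.
by move=> [g [h ->]] [g' [h' ->]]; exists (g + g'), (h + h'); ring.
Qed.

Lemma theta_dvdM s t a b : theta_dvd s a -> theta_dvd t b -> theta_dvd (s + t) (a * b).
Proof.
move=> [g [h ->]] [g' [h' ->]].
exists (g * g'), (h * ('X^t * g' + eisenstein Zp * h') + 'X^s * g * h').
by rewrite exprD; ring.
Qed.

Lemma theta_dvd_trivial a : theta_dvd 0 a.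
Proof. by exists a, 0; rewrite expr0; ring. Qed.

Lemma theta_dvdMr s a b : theta_dvd s a -> theta_dvd s (a * b).
Proof. by move=> h; rewrite -[s]addn0; apply: theta_dvdM h (theta_dvd_trivial b). Qed.

Lemma theta_dvdX s a n : theta_dvd s a -> theta_dvd (s * n) (a ^+ n).
Proof.
move=> h; elim: n => [|n IH]; first by rewrite muln0; apply: theta_dvd_trivial.
by rewrite exprS mulnS; apply: theta_dvdM.
Qed.

Lemma theta_dvd_le s t a : (s <= t)%N -> theta_dvd t a -> theta_dvd s a.
Proof.
move=> /subnKC <- [g [h ->]]; exists ('X^(t - s) * g), h.
by rewrite exprD mulrA.
Qed.

Lemma theta_dvd_p : theta_dvd 1 p%:R.
Proof.
exists 'X^(N.-1), (-1); rewrite -exprD add1n prednK // /eisenstein polyC_natr.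
by ring.
Qed.

Lemma eisenstein_pX (A : comNzRingType) k :
  exists h, 'X^(N * k) = (p ^ k)%:R + eisenstein A * h :> {poly A}.
Proof.
have e := subrXX ('X^N : {poly A}) p%:R k.
rewrite /eisenstein polyC_natr; set S := \sum_(i < k) _ in e; exists S.
by rewrite -e -exprM natrX addrC subrK.
Qed.

Lemma theta_dvd_pX k w : theta_dvd (N * k) ((p ^ k)%:R * w).
Proof.
have [h e] := eisenstein_pX Zp k; exists w, (- h * w).
by rewrite e; ring.
Qed.

Lemma theta_dvd_near k w : theta_dvd (N * k) w -> pow_dvd_mod k (eK w).
Proof.
move=> [g [h ->]]; rewrite rmorphD !rmorphM /= map_polyXn eK_eis.
have [h' ->] := eisenstein_pX K k.
rewrite mulrDl -addrA -mulrA -mulrDr; apply: pow_dvd_modD (pow_dvd_mod_eis _ _).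
exact: pow_dvd_modMr (pow_dvd_mod_pX k) (pow_dvd_mod_eK g).
Qed.

Lemma theta_dvd_residue w : theta_dvd 1 w \/ theta_dvd 1 (w ^+ p.-1 - 1).
Proof.
elim/poly_ind: w => [|w c _]; first by left; apply: theta_dvd0.
have dX : theta_dvd 1 (w * 'X) by exists w, 0; rewrite expr1; ring.
have dp y : theta_dvd 1 (p%:R * y) by apply: theta_dvdMr theta_dvd_p.
case: (zp_residue c) => -[y ey].
  by left; apply: theta_dvdD dX _; rewrite ey polyCM polyC_natr; apply: dp.
right; have := subrXX (w * 'X + c%:P) c%:P p.-1; rewrite addrK.
set z := \sum_(i < _) _ => e.
have -> : (w * 'X + c%:P) ^+ p.-1 - 1 = w * 'X * z + p%:R * y%:P.
  by rewrite -e -[c%:P ^+ _]rmorphXn /= ey polyCD polyCM polyC_natr polyC1; ring.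
by apply: theta_dvdD => //; apply: theta_dvdMr.
Qed.

(** If [u = 1] modulo [theta ^ j], where [j > 0], then [u ^ p - 1] is the product of
    [u - 1] and of a sum of [p] terms congruent to [1], which is [0] modulo
    [theta]. *)
Lemma theta_dvd_unit w j : ~ theta_dvd 1 w -> theta_dvd j.+1 (w ^+ (p.-1 * p ^ j) - 1).
Proof.
move=> nw; elim: j => [|j IH].
  by rewrite expn0 muln1; case: (theta_dvd_residue w).
rewrite expnSr mulnA exprM; set u := w ^+ _ in IH *.
have d1 : theta_dvd 1 (u - 1) by apply: theta_dvd_le IH.
rewrite subrX1 -addn1; apply: theta_dvdM => //.
have -> : \sum_(i < p) u ^+ i = \sum_(i < p) (u ^+ i - 1) + p%:R.
  by rewrite sumrB sumr_const card_ord subrK.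
apply: theta_dvdD theta_dvd_p; apply: big_ind => [||i _];
  [exact: theta_dvd0|exact: theta_dvdD|].
by rewrite subrX1; apply: theta_dvdMr.
Qed.

(** The powers [w ^ ((p - 1) p ^ j)] tend to [0] on the maximal ideal and to [1]
    outside it, which gives the case [s = 1].  For [s + 1], the function obtained
    for [s] is evaluated at [w / theta]; outside the maximal ideal its values
    are bounded but otherwise unknown, and the factor obtained for [s = 1], taken
    with a precision that exceeds this bound, removes them. *)
Lemma indicator_approx s k : exists f : {poly {poly K}}, forall w,
  (theta_dvd s w -> pow_dvd_mod k (f.[eK w] - 1)) /\ (~ theta_dvd s w ->
    pow_dvd_mod k f.[eK w]).
Proof.
elim: s k => [|s IH] k.
  exists 1 => w; split; last by case; apply: theta_dvd_trivial.
  by rewrite hornerC subrr => _; apply: pow_dvd_mod0.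
have [g hg] := IH k.
(* [c] is the inverse of [theta]. *)
pose c : {poly K} := p%:R^-1 *: 'X^(N.-1).
pose g' := g \Po (c *: 'X).
have [d hd] := horner_bounded g'.
pose M := (p.-1 * p ^ (N * (k + d)))%N.
exists ((1 - 'X^M) * g') => w; rewrite hornerM.
have -> : (1 - 'X^M : {poly {poly K}}).[eK w] = 1 - eK w ^+ M.
  by rewrite !hornerE.
have {}hd := hd w; set B := g'.[eK w] in hd *.
have leM : (N * (k + d) <= M)%N.
  rewrite /M; apply: leq_trans (leq_pmull _ _);
    last by rewrite -ltnS prednK ?prime_gt1 ?prime_gt0.
  by apply: ltnW; apply: ltn_expl; apply: prime_gt1.
case: (pselect (theta_dvd 1 w)) => dw; last first.
  split=> h; first by case: dw; apply: theta_dvd_le h.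
  apply: pow_dvd_mod_shift hd; rewrite -opprB; apply: pow_dvd_modN.
  rewrite -(rmorph1 eK) -rmorphXn -rmorphB; apply: theta_dvd_near.
  by apply: theta_dvd_le (theta_dvd_unit _ dw).
have nA : pow_dvd_mod k (eK w ^+ M * B).
  apply: pow_dvd_mod_shift hd; rewrite -rmorphXn; apply: theta_dvd_near.
  by apply: theta_dvd_le leM _; have := theta_dvdX M dw; rewrite mul1n.
have pK : p%:R != 0 :> K by rewrite natK_neq0 ?prime_gt0.
(* Hence [g'] at [w = theta w'] agrees with [g] at [w']. *)
have gB w' h' : w = 'X * w' + eisenstein Zp * h' -> exists h, B = g.[eK w'] + eisenstein
  K * h.
  move=> ew; rewrite /B /g' horner_comp hornerZ hornerX ew rmorphD !rmorphM /=.
  rewrite map_polyX eK_eis.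
  have -> : c * ('X * eK w' + eisenstein K * eK h') =
     eK w' + eisenstein K * ((p%:R^-1)%:P * eK w' + c * eK h').
    have cX : c * 'X = 1 + eisenstein K * (p%:R^-1)%:P.
      rewrite /c -scalerAl -exprSr prednK // /eisenstein mulrBl -polyCM mulfV //.
      by rewrite polyC1 addrC subrK mulrC mul_polyC.
    by rewrite mulrDr !mulrA cX; ring.
  exact: horner_eis.
split=> h.
  case: h => g0 [h0 ew].
  have [|h eB] := gB ('X^s * g0) h0; first by rewrite mulrA -exprS.
  have -> : (1 - eK w ^+ M) * B - 1 =
     (g.[eK ('X^s * g0)] - 1) + eisenstein K * h - eK w ^+ M * B.
    by rewrite eB; ring.
  apply: pow_dvd_modD (pow_dvd_modN nA); apply: pow_dvd_modD (pow_dvd_mod_eis _ _).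
  by apply: (hg _).1; exists g0, 0; ring.
case: dw => w' [h' ew]; rewrite expr1 in ew.
have [h0 eB] := gB _ _ ew.
rewrite mulrBl mul1r; apply: pow_dvd_modD (pow_dvd_modN nA).
rewrite eB; apply: pow_dvd_modD (pow_dvd_mod_eis _ _); apply: (hg _).2 => -[g0 [h1 e1]].
by apply: h; exists g0, ('X * h1 + h'); rewrite ew e1 exprS; ring.
Qed.

Lemma pow_dvd_mod_const k (c : K) : pow_dvd_mod k c%:P -> pow_dvd v k c.
Proof.
move=> [g [h e]].
have sc : (size c%:P <= N)%N by rewrite (leq_trans (size_polyC_leq1 c)).
have [|r er] := @low_degree_dvd _ _ (@valK p pp K v) p%:R (p ^ k)%:R N c%:P h g N_gt0 sc.
  by rewrite e rmorph_nat scaler_nat mulr_natl.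
exists r`_0; have := congr1 (fun a : {poly K} => a`_0) er.
by rewrite coefC coefZ coef_map.
Qed.

(** The integral of an approximation of the indicator function is a combination of
    moments, with coefficients that depend only on the coset and on the precision;
    this holds with uniform [I] and [d] for all finitely supported measures. *)
Lemma moments_mass s k (w0 : {poly Zp}) : exists I d,
  forall l : seq (R * {poly Zp}),
  (forall i, (i < I)%N -> exists g : {poly R},
      \sum_(x <- l) (valK x.1)%:P * eK x.2 ^+ i = (p ^ d)%:R * rK g) ->
  pow_dvd v k (\sum_(x <- l | `[< theta_dvd s (x.2 - w0) >]) valK x.1).
Proof.
have [f hf] := indicator_approx s k.
pose F := f \Po ('X - (eK w0)%:P).
have eF w : F.[eK w] = f.[eK (w - w0)].
  by rewrite horner_comp hornerXsubC rmorphB.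
have [d hd] : exists d, forall i, pow_dvd_mod 0 ((p ^ d)%:R * F`_i).
  elim/poly_ind: F {eF} => [|F c [d IH]].
    by exists 0%N => i; rewrite coef0 mulr0; apply: pow_dvd_mod0.
  have [d' hc] := pow_dvd_mod_bounded c.
  have nat0 a : pow_dvd_mod 0 a%:R by rewrite -(rmorph_nat rK); apply: pow_dvd_mod_rK.
  exists (d + d')%N => i; rewrite expnD natrM coefD coefMX coefC mulrDr.
  apply: pow_dvd_modD; case: i => [|i] /=; rewrite ?mulr0; try exact: pow_dvd_mod0.
    by rewrite mulrAC; apply: pow_dvd_modMl.
  by rewrite -mulrA; apply: pow_dvd_modMl.
exists (size F), (k + d)%N => l hl; apply: pow_dvd_mod_const.
pose T := \sum_(x <- l) (valK x.1)%:P * F.[eK x.2].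
have nT : pow_dvd_mod k T.
  have -> : T = \sum_(i < size F)
       (\sum_(x <- l) (valK x.1)%:P * eK x.2 ^+ i) * F`_i.
    under [RHS]eq_bigr => i _ do rewrite mulr_suml.
    rewrite exchange_big /=; apply: eq_bigr => x _.
    rewrite horner_coef mulr_sumr; apply: eq_bigr => i _.
    by rewrite -mulrA [F`_i * _]mulrC.
  apply: pow_dvd_mod_sum => i _; have [g ->] := hl i (ltn_ord i).
  exact: pow_dvd_mod_shift (pow_dvd_modMr (pow_dvd_mod_pX _) (pow_dvd_mod_rK _)) (hd i).
rewrite rmorph_sum /= big_mkcond /=.
rewrite -[\sum_(x <- l) _](subrK T); apply: pow_dvd_modD nT; rewrite -sumrB.
apply: pow_dvd_mod_sum => x _; rewrite eF; have [h1 h2] := hf (x.2 - w0).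
have nc : pow_dvd_mod 0 (valK x.1)%:P by rewrite -(map_polyC (@valK p pp K v));
  apply: pow_dvd_mod_rK.
case: asboolP => [/h1|/h2] h.
  rewrite -[X in X - _]mulr1 -mulrBr -opprB mulrN; apply: pow_dvd_modN.
  by apply: pow_dvd_modMl.
by rewrite sub0r; apply: pow_dvd_modN; apply: (@pow_dvd_modM 0 k).
Qed.

Lemma theta_dvd_low_degree k (w : {poly Zp}) : (size w <= N)%N -> theta_dvd (N * k) w ->
  exists r, w = (p ^ k)%:R *: r.
Proof.
move=> sw [g [h]]; have [h' ->] := eisenstein_pX Zp k => e.
have [|r er] := @low_degree_dvd _ _ idfun p%:R (p ^ k)%:R N w (h' * g + h) g N_gt0 sw.
  by rewrite map_poly_id // e scaler_nat -mulr_natl /= /eisenstein; ring.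
by exists r; rewrite er map_poly_id.
Qed.

End Kaplansky.

(** * Quadratic forms at powers of theta *)

Section SymmetricForms.
Variables (p : nat) (pp : prime p) (n : nat).
Local Notation Zp := (Defs.Zp pp).

Definition form_deg := (2 ^ n).+1.

Definition form_at_powers (y : 'M[Zp]_n) : {poly Zp} :=
  \sum_(a < n) \sum_(b < n) (y a b)%:P * 'X^(2 ^ a + 2 ^ b).

Lemma pow2_sum_lt a b c d : (a <= b)%N -> (c <= d)%N -> (b < d)%N ->
  (2 ^ a + 2 ^ b < 2 ^ c + 2 ^ d)%N.
Proof.
move=> ab cd bd; apply: (@leq_ltn_trans (2 ^ d)).
  apply: (@leq_trans (2 ^ b.+1)); last by rewrite leq_exp2l.
  by rewrite expnS mul2n -addnn leq_add2r leq_exp2l.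
by rewrite -[X in (X < _)%N]add0n ltn_add2r expn_gt0.
Qed.

Lemma pow2_sum_inj a b c d : ((2 ^ a + 2 ^ b == 2 ^ c + 2 ^ d) =
  ((a == c) && (b == d)) || ((a == d) && (b == c)))%N.
Proof.
apply/idP/idP; last first.
  by case/orP => /andP[/eqP-> /eqP->] //; rewrite addnC.
wlog ab : a b / (a <= b)%N.
  by move=> h; case/orP: (leq_total a b) => /h // h'; rewrite addnC => /h';
    rewrite orbC andbC [X in _ || X]andbC.
wlog cd : c d / (c <= d)%N.
  by move=> h; case/orP: (leq_total c d) => /h // h'; rewrite [X in _ == X]addnC => /h';
    rewrite orbC.
move=> /eqP e; apply/orP; left.
have bd : b = d.
  case: (ltngtP b d) => // lt; [have := pow2_sum_lt ab cd lt|have := pow2_sum_lt cd ab lt];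
  by rewrite e ltnn.
by move: e; rewrite bd eqxx andbT => /addIn /(expnI (isT : 1 < 2)%N) ->.
Qed.

Lemma size_form_at_powers y : (size (form_at_powers y) <= form_deg)%N.
Proof.
apply: (big_ind (fun u : {poly Zp} => size u <= form_deg)%N).
- by rewrite size_poly0.
- by move=> u w hu hw; rewrite (leq_trans (size_polyD _ _)) // geq_max hu.
move=> a _; apply: (big_ind (fun u : {poly Zp} => size u <= form_deg)%N).
- by rewrite size_poly0.
- by move=> u w hu hw; rewrite (leq_trans (size_polyD _ _)) // geq_max hu.
move=> b _; rewrite mul_polyC (leq_trans (size_scale_leq _ _)) // size_polyXn ltnS.
have le i : (i < n)%N -> (2 ^ i <= 2 ^ n.-1)%N by move=> h;
  rewrite leq_exp2l // -ltnS prednK // (leq_trans _ h).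
apply: leq_trans (leq_add (le _ (ltn_ord a)) (le _ (ltn_ord b))) _.
by rewrite addnn -mul2n -expnS prednK // (leq_trans _ (ltn_ord a)).
Qed.

Lemma form_at_powersB y z :
  form_at_powers (y - z) = form_at_powers y - form_at_powers z.
Proof.
rewrite /form_at_powers -sumrB; apply: eq_bigr => a _.
rewrite -sumrB; apply: eq_bigr => b _.
by rewrite !mxE polyCB mulrBl.
Qed.

Lemma coef_form_at_powers y (a b : 'I_n) : y^T = y ->
  (form_at_powers y)`_(2 ^ a + 2 ^ b) = (if a == b then 1 else 2%:R) * y a b.
Proof.
move=> ys; rewrite /form_at_powers coef_sum.
under eq_bigr => c _.
  rewrite coef_sum; under eq_bigr => d _ do rewrite coefCM coefXn pow2_sum_inj !(inj_eq
    val_inj).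
  over.
have ind (c0 d0 : 'I_n) (F : 'I_n -> 'I_n -> Zp) :
    \sum_c \sum_d F c d * ((c == c0) && (d == d0))%:R = F c0 d0.
  rewrite (bigD1 c0) //= [X in _ + X]big1 => [|c /negPf cc]; last first.
    by rewrite big1 // => d _; rewrite cc mulr0.
  rewrite addr0 (bigD1 d0) //= [X in _ + X]big1 => [|d /negPf dd]; last first.
    by rewrite dd andbF mulr0.
  by rewrite !eqxx mulr1 addr0.
have [<-|ab] := eqVneq a b.
  rewrite mul1r -[RHS](ind a a (fun c d => y c d)).
  apply: eq_bigr => c _; apply: eq_bigr => d _.
  by rewrite [(a == d) && _]andbC orbb ![a == _]eq_sym.
have yba : y b a = y a b by rewrite -{1}ys mxE.
rewrite mulr_natl mulr2n -{1}(ind a b (fun c d => y c d)) -yba -{1}(ind b a (fun c d => y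
  c d)).
rewrite -big_split; apply: eq_bigr => c _; rewrite -big_split; apply: eq_bigr => d _ /=.
rewrite -mulrDr; congr (_ * _); rewrite ![c == _]eq_sym ![d == _]eq_sym.
case: andP => [[/eqP<- /eqP<-]|_] /=; last by rewrite add0r andbC.
by rewrite eq_sym (negPf ab) addr0.
Qed.

(** The exponents [2 ^ a] form a Sidon set, so the values at
    [x_a = theta ^ (2 ^ a)] of the forms [x^T y x] determine [y], and do so at
    every finite level. *)
Lemma form_at_powers_dvd m y : odd p -> y^T = y ->
  theta_dvd form_deg (form_deg * m) (form_at_powers y) ->
  exists y', y = (p ^ m)%:R *: y'.
Proof.
move=> p_odd ys /(theta_dvd_low_degree (ltn0Sn _) (size_form_at_powers y))[r er].
have dv a b : exists z, y a b = (p ^ m)%:R * z.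
  have e : (if a == b then 1 else 2%:R) * y a b = (p ^ m)%:R * r`_(2 ^ a + 2 ^ b).
    by rewrite -coef_form_at_powers // er coefZ.
  move: e; case: eqP => _ e; first by exists (r`_(2 ^ a + 2 ^ b)); rewrite -e mul1r.
  apply: (@zp_cancel_coprime _ _ 2); first by rewrite coprimen2.
  by eexists; exact: e.
exists (\matrix_(a, b) projT1 (cid (dv a b))).
by apply/matrixP => a b; rewrite !mxE; case: cid.
Qed.

End SymmetricForms.

(** * The lattice of integral polynomials *)

Section PolynomialLattice.
Variables (p : nat) (pp : prime p) (K : fieldExtType (Qp pp)) (v : valuation K).
Variable n : nat.
Local Notation R := (valring v).
Local Notation V := {mpoly K[n]}.

Definition mpoly_pow_dvd k (u : V) := forall m, pow_dvd v k u@_m.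

Lemma mpoly_pow_dvdD k u w : mpoly_pow_dvd k u -> mpoly_pow_dvd k w ->
  mpoly_pow_dvd k (u + w).
Proof. by move=> hu hw m; rewrite mcoeffD; apply: pow_dvdD. Qed.

Lemma mpoly_pow_dvdN k u : mpoly_pow_dvd k u -> mpoly_pow_dvd k (- u).
Proof. by move=> hu m; rewrite mcoeffN; apply: pow_dvdN. Qed.

Lemma mpoly_pow_dvd0 k : mpoly_pow_dvd k 0.
Proof. by move=> m; rewrite mcoeff0; apply: pow_dvd0. Qed.

Lemma mpoly_pow_dvdZ k l c u : pow_dvd v k c -> mpoly_pow_dvd l u ->
  mpoly_pow_dvd (k + l) (c *: u).
Proof. by move=> hc hu m; rewrite mcoeffZ; apply: pow_dvdM. Qed.

Lemma pow_dvd_le k l c : pow_dvd v (k + l) c -> pow_dvd v k c.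
Proof.
move=> [r ->]; exists ((p ^ l)%:R * r).
by rewrite rmorphM rmorph_nat mulrA -natrM expnD.
Qed.

Lemma mpoly_pow_dvd_le k l u : (k <= l)%N -> mpoly_pow_dvd l u -> mpoly_pow_dvd k u.
Proof. by move=> /subnKC <- hu m; apply: pow_dvd_le (hu m). Qed.

Lemma mpoly_pow_dvd_div k d u : mpoly_pow_dvd (k + d) ((p ^ d)%:R *: u) ->
  mpoly_pow_dvd k u.
Proof.
move=> hu m; have [r] := hu m; rewrite mcoeffZ expnD natrM -mulrA mulrCA => e.
by exists r; apply: (mulfI (pX_neq0 K d)).
Qed.

Lemma mpoly_pow_dvd1 : mpoly_pow_dvd 0 1.
Proof. by move=> m; rewrite mcoeff1; apply: pow_dvd_nat. Qed.

Lemma mpoly_pow_dvdM k l u w : mpoly_pow_dvd k u -> mpoly_pow_dvd l w ->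
  mpoly_pow_dvd (k + l) (u * w).
Proof. by move=> hu hw m; rewrite mcoeffM; apply: pow_dvd_sum => x _; apply: pow_dvdM. Qed.

Lemma mpoly_pow_dvdX i : mpoly_pow_dvd 0 'X_i.
Proof. by move=> m; rewrite mcoeffX; apply: pow_dvd_nat. Qed.

Lemma mpoly_pow_dvd_deriv k i u : mpoly_pow_dvd k u -> mpoly_pow_dvd k u^`M(i).
Proof.
move=> hu m; rewrite mcoeff_deriv -mulr_natl.
by apply: pow_dvdMl => //; apply: pow_dvd_nat.
Qed.

Lemma mpoly_bounded (u : V) : exists d, mpoly_pow_dvd 0 ((p ^ d)%:R *: u).
Proof.
elim/mpolyind: u => [|c m u _ _ [d IH]].
  by exists 0%N; rewrite scaler0; apply: mpoly_pow_dvd0.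
have [e he] := pow_dvd_bounded v c; exists (e + d)%N.
rewrite scalerDr scalerA expnD natrM; apply: mpoly_pow_dvdD.
  apply: (@mpoly_pow_dvdZ 0 0); first by rewrite mulrAC; apply: pow_dvdMl => //;
    apply: pow_dvd_nat.
  by move=> m'; rewrite mcoeffX; apply: pow_dvd_nat.
by rewrite -scalerA; apply: (@mpoly_pow_dvdZ 0 0) IH; apply: pow_dvd_nat.
Qed.

End PolynomialLattice.

(** * Actions of presented algebras *)

Section TermAction.
Variables (S K : comPzRingType) (phi : {rmorphism S -> K}) (G : Type).
Variables (V : lmodType K) (gen : G -> V -> V).

Fixpoint term_action (t : term S G) (u : V) : V :=
  match t with
  | Gen g => gen g u
  | Cst r => phi r *: u
  | Add s t => term_action s u + term_action t u
  | Mul s t => term_action s (term_action t u)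
  end.

Definition subspace (P : V -> Prop) :=
  P 0 /\ forall c u w, P u -> P w -> P (c *: u + w).

Lemma subspaceD P u w : subspace P -> P u -> P w -> P (u + w).
Proof. by move=> [_ h] hu hw; rewrite -[u]scale1r; apply: h. Qed.

Lemma subspaceZ P c u : subspace P -> P u -> P (c *: u).
Proof. by move=> [h0 h] hu; rewrite -[c *: u]addr0; apply: h. Qed.

Lemma subspaceN P u : subspace P -> P u -> P (- u).
Proof. by move=> h hu; rewrite -scaleN1r; apply: subspaceZ. Qed.

Hypothesis gen_linear : forall g c u w,
  gen g (c *: u + w) = c *: gen g u + gen g w.

Lemma term_action_linear t c u w :
  term_action t (c *: u + w) = c *: term_action t u + term_action t w.
Proof.
elim: t c u w => [g|r|s IHs t IHt|s IHs t IHt] c u w /=.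
- exact: gen_linear.
- by rewrite scalerDr !scalerA [c * _]mulrC.
- by rewrite IHs IHt scalerDr addrACA.
- by rewrite IHt IHs.
Qed.

Lemma term_actionD t u w : term_action t (u + w) = term_action t u + term_action t w.
Proof. by rewrite -[u]scale1r term_action_linear !scale1r. Qed.

Lemma term_actionB t u w : term_action t (u - w) = term_action t u - term_action t w.
Proof. by rewrite addrC -scaleN1r term_action_linear scaleN1r addrC. Qed.

Lemma term_actionZ t c u : term_action t (c *: u) = c *: term_action t u.
Proof.
have t0 : term_action t 0 = 0 by rewrite -[X in term_action t X](subrr 0) term_actionB
  subrr.
by rewrite -[X in term_action t X]addr0 term_action_linear t0 addr0.
Qed.

Lemma term_action_stable (P : V -> Prop) t u : subspace P ->
  (forall g u, P u -> P (gen g u)) -> P u -> P (term_action t u).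
Proof.
move=> hP hg; elim: t u => [g|r|s IHs t IHt|s IHs t IHt] u hu /=.
- exact: hg.
- exact: subspaceZ.
- by apply: subspaceD; auto.
- by auto.
Qed.

(** The subquotient [B / N] is the form required for sequences: there the relations
    hold only on bounded sequences, and only up to null sequences. *)
Lemma term_action_cong (B N : V -> Prop) (rel : term S G -> term S G -> Prop) s t u :
  subspace B -> subspace N ->
  (forall g u, B u -> B (gen g u)) -> (forall g u, N u -> N (gen g u)) ->
  (forall s t u, rel s t -> B u -> N (term_action s u - term_action t u)) ->
  cong rel s t -> B u -> N (term_action s u - term_action t u).
Proof.
move=> hB hN gB gN hrel st; have N0 := hN.1.
have eqN (x y : V) : x = y -> N (x - y) by move=> ->; rewrite subrr.
elim: st u => {s t}.
- by move=> s t st u; apply: hrel.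
- by move=> s u _; apply: eqN.
- by move=> s t _ IH u Bu; rewrite -opprB; apply: subspaceN (IH _ Bu).
- move=> s t w _ IH1 _ IH2 u Bu.
  by have := subspaceD hN (IH1 _ Bu) (IH2 _ Bu); rewrite addrA subrK.
- move=> s s' t t' _ IH1 _ IH2 u Bu /=.
  by rewrite opprD addrACA; apply: subspaceD; auto.
- move=> s s' t t' _ IH1 _ IH2 u Bu /=.
  have Bt' := term_action_stable t' hB gB Bu.
  have := subspaceD hN (term_action_stable s hN gN (IH2 _ Bu)) (IH1 _ Bt').
  by rewrite term_actionB addrA subrK.
- by move=> s t w u _; apply: eqN; rewrite /= addrA.
- by move=> s t u _; apply: eqN; rewrite /= addrC.
- by move=> s u _; apply: eqN; rewrite /= rmorph0 scale0r add0r.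
- by move=> s t w u _; apply: eqN.
- by move=> s u _; apply: eqN; rewrite /= rmorph1 scale1r.
- by move=> s u _; apply: eqN; rewrite /= rmorph0 !scale0r.
- by move=> s t w u _; apply: eqN.
- by move=> s t w u _; apply: eqN; rewrite /= term_actionD.
- by move=> a b u _; apply: eqN; rewrite /= rmorphD scalerDl.
- by move=> a b u _; apply: eqN; rewrite /= rmorphM scalerA.
- by move=> a s u _; apply: eqN; rewrite /= term_actionZ.
Qed.

End TermAction.

Section PresentedAction.
Variables (S K : comPzRingType) (phi : {rmorphism S -> K}) (G : Type).
Variables (V : lmodType K) (gen : G -> V -> V) (rel : term S G -> term S G -> Prop).
Local Notation A := (presented rel).
Local Notation act := (term_action phi gen).

Definition presented_action (a : A) (u : V) : V := act (qrepr a) u.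

Hypothesis gen_linear : forall g c u w,
  gen g (c *: u + w) = c *: gen g u + gen g w.
Hypothesis rel_action : forall s t u, rel s t -> act s u = act t u.

Lemma presented_action_cls t u : presented_action (cls (S := A) t) u = act t u.
Proof.
have /cls_eq st := qreprK (cls (S := A) t); apply/eqP; rewrite -subr_eq0; apply/eqP.
have sub0 : subspace (fun w : V => w = 0).
  by split=> // c w w' -> ->; rewrite scaler0 addr0.
have subT : subspace (fun w : V => True) by split.
apply: (term_action_cong gen_linear subT sub0 _ _ _ st) => //.
- by move=> g w ->; have := gen_linear g (-1) 0 0; rewrite scaler0 addr0 scaleN1r addNr.
- by move=> s' t' w st' _; rewrite (rel_action _ st') subrr.
Qed.

Lemma presented_action_linear a c u w :
  presented_action a (c *: u + w) = c *: presented_action a u + presented_action a w.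
Proof. exact: term_action_linear gen_linear _ _ _ _. Qed.

Lemma presented_actionZ a c u : presented_action a (c *: u) = c *: presented_action a u.
Proof. exact: term_actionZ gen_linear _ _ _. Qed.

Lemma presented_actionD a a' u :
  presented_action (a + a') u = presented_action a u + presented_action a' u.
Proof.
have [s ->] := cls_surj a; have [t ->] := cls_surj a'.
by rewrite [_ + _]q_addE !presented_action_cls.
Qed.

Lemma presented_actionB a a' u :
  presented_action (a - a') u = presented_action a u - presented_action a' u.
Proof. by apply/eqP; rewrite eq_sym subr_eq -presented_actionD subrK. Qed.

Lemma presented_actionM a a' u :
  presented_action (a * a') u = presented_action a (presented_action a' u).
Proof.
have [s ->] := cls_surj a; have [t ->] := cls_surj a'.
by rewrite [_ * _]q_mulE !presented_action_cls.
Qed.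

Lemma presented_action_cst (r : S) u : presented_action (r *: (1 : A)) u = phi r *: u.
Proof.
have -> : r *: (1 : A) = cls (S := A) (Mul (Cst r) (Cst 1)) by exact: q_mulE.
by rewrite presented_action_cls /= rmorph1 scale1r.
Qed.

Lemma presented_action_scale (r : S) a u :
  presented_action (r *: a) u = phi r *: presented_action a u.
Proof. by rewrite -[a in LHS]mul1r q_scaleAl presented_actionM presented_action_cst. Qed.

Lemma presented_action0 u : presented_action 0 u = 0.
Proof. by rewrite -(subrr (0 : A)) presented_actionB subrr. Qed.

Lemma presented_action_gen g u : presented_action (pgen rel g) u = gen g u.
Proof. exact: presented_action_cls. Qed.

End PresentedAction.

(** * The Weyl algebra acting on polynomials *)

Section WeylAction.
Variables (p : nat) (pp : prime p) (K : fieldExtType (Qp pp)) (v : valuation K).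
Variables (n : nat) (b : bool).
Local Notation R := (valring v).
Local Notation V := {mpoly K[n]}.
Local Notation W := (weyl v n).
Local Notation mpoly_pow_dvd := (mpoly_pow_dvd v).

(** The Fourier transform, which sends [x_i] to [- d_i] and [d_i] to [x_i],
    exchanges the two cases; in both, the generators that occur in the
    representation of the block algebra act by multiplication. *)
Definition mul_gen (i : 'I_n) : 'I_n + 'I_n := if b then inr i else inl i.

Definition gen_action (g : 'I_n + 'I_n) (u : V) : V :=
  match g, b with
  | inl i, false | inr i, true => 'X_i * u
  | inr i, false => u^`M(i)
  | inl i, true => - u^`M(i)
  end.

Lemma gen_action_linear g c u w :
  gen_action g (c *: u + w) = c *: gen_action g u + gen_action g w.
Proof.
by case: g => i; rewrite /gen_action; case: b;
  rewrite ?mulrDr ?scalerAr // mderivD mderivZ ?opprD ?scalerN.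
Qed.

Lemma gen_action_mul i u : gen_action (mul_gen i) u = 'X_i * u.
Proof. by rewrite /gen_action /mul_gen; case: b. Qed.

Lemma mpoly_pow_dvd_gen_action k g u : mpoly_pow_dvd k u ->
  mpoly_pow_dvd k (gen_action g u).
Proof.
move=> hu; rewrite /gen_action; case: g => i; case: b.
- by apply/mpoly_pow_dvdN/mpoly_pow_dvd_deriv.
- exact: (mpoly_pow_dvdM (mpoly_pow_dvdX v i) hu).
- exact: (mpoly_pow_dvdM (mpoly_pow_dvdX v i) hu).
- exact: mpoly_pow_dvd_deriv.
Qed.

Lemma weyl_rel_action s t u : @weyl_rel _ _ _ v n s t ->
  term_action (@valK p pp K v) gen_action s u = term_action (@valK p pp K v) gen_action t u.
Proof.
have dX (i j : 'I_n) (w : V) :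
    ('X_j * w)^`M(i) = 'X_j * w^`M(i) + (i == j)%:R *: w.
  rewrite mderivM mderivX mnm1E eq_sym addrC; case: eqP => [->|_].
    have -> : (U_(j) - U_(j))%MM = 0%MM by apply/mnmP => k; rewrite mnmBE mnm0E subnn.
    by rewrite mpolyX0 !scale1r mul1r.
  by rewrite !scale0r mul0r.
case=> i j /=; rewrite /gen_action; case: b => /=.
- by rewrite !mderivN (mderiv_comm i j).
- by rewrite mulrCA.
- by rewrite mulrCA.
- by rewrite (mderiv_comm j i).
- by rewrite dX opprD mulrN rmorph_nat eq_sym subrK.
- by rewrite dX rmorph_nat.
Qed.

Local Notation act := (term_action (@valK p pp K v) gen_action).

Definition weyl_action (a : W) (u : V) : V :=
  presented_action (@valK p pp K v) gen_action a u.

Lemma weyl_action_linear a c u w :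
  weyl_action a (c *: u + w) = c *: weyl_action a u + weyl_action a w.
Proof. exact: presented_action_linear gen_action_linear _ _ _ _. Qed.

Lemma weyl_actionZ a c u : weyl_action a (c *: u) = c *: weyl_action a u.
Proof. exact: presented_actionZ gen_action_linear _ _ _. Qed.

Lemma weyl_actionD a a' u :
  weyl_action (a + a') u = weyl_action a u + weyl_action a' u.
Proof. exact: (presented_actionD gen_action_linear weyl_rel_action). Qed.

Lemma weyl_actionB a a' u :
  weyl_action (a - a') u = weyl_action a u - weyl_action a' u.
Proof. exact: (presented_actionB gen_action_linear weyl_rel_action). Qed.

Lemma weyl_actionM a a' u :
  weyl_action (a * a') u = weyl_action a (weyl_action a' u).
Proof. exact: (presented_actionM gen_action_linear weyl_rel_action). Qed.

Lemma weyl_action_cst (r : R) u : weyl_action (r *: (1 : W)) u = valK r *: u.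
Proof. exact: (presented_action_cst gen_action_linear weyl_rel_action). Qed.

Lemma weyl_action_gen i u :
  weyl_action (pgen (@weyl_rel _ _ _ v n) (mul_gen i)) u = 'X_i * u.
Proof. by rewrite -gen_action_mul;
  apply: presented_action_gen gen_action_linear weyl_rel_action _ _. Qed.

Lemma mpoly_pow_dvd_weyl_action k a u : mpoly_pow_dvd k u ->
  mpoly_pow_dvd k (weyl_action a u).
Proof.
rewrite /weyl_action /presented_action;
  elim: (qrepr a) u => [g|r|s IHs t IHt|s IHs t IHt] u hu /=.
- exact: mpoly_pow_dvd_gen_action.
- exact: mpoly_pow_dvdZ (pow_dvd_valK _) hu.
- by apply: mpoly_pow_dvdD; auto.
- by auto.
Qed.

(** This is what makes the action extend to the completion. *)
Lemma mpoly_pow_dvd_ideal k l a u : idl (fun k : nat => [set (p ^ k)%:R : W]%classic) k a ->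
  mpoly_pow_dvd l u -> mpoly_pow_dvd (k + l) (weyl_action a u).
Proof.
move=> ia; elim: ia u => {a} [|_ ->|a a' _ IH _ IH'|a a' _ IH|a a' _ IH] u hu.
- rewrite -(scale0r (1 : W)).
  by rewrite weyl_action_cst rmorph0 scale0r; apply: mpoly_pow_dvd0.
- rewrite -[_%:R](scaler_nat (p ^ k) (1 : W)) weyl_action_cst rmorph_nat.
  exact: mpoly_pow_dvdZ (pow_dvd_pX _ _) hu.
- by rewrite weyl_actionD; apply: mpoly_pow_dvdD; auto.
- by rewrite weyl_actionM; apply: mpoly_pow_dvd_weyl_action; auto.
- by rewrite weyl_actionM; apply: IH; apply: mpoly_pow_dvd_weyl_action.
Qed.

End WeylAction.

(** * The completed Weyl algebra acting on sequences of polynomials *)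

Section CompletedWeylAction.
Variables (p : nat) (pp : prime p) (K : fieldExtType (Qp pp)) (v : valuation K).
Variables (n : nat) (b : bool).
Local Notation R := (valring v).
Local Notation V := {mpoly K[n]}.
Local Notation W := (weyl v n).
Local Notation Wc := (padic_completion W).
Local Notation WK := (completion_K W).
Local Notation mpoly_pow_dvd := (mpoly_pow_dvd v).
Local Notation pX := (fun k : nat => [set (p ^ k)%:R : W]%classic).
Local Notation rel := (@base_change_rel R K (@valring_val _ _ _ v) Wc).

(** The completed algebra acts on bounded sequences of polynomials modulo null
    sequences: this is a space on which [p] is invertible, and it contains the
    constant sequences, so neither completing the lattice nor localizing it is
    required. *)
Definition bounded_seq (u : nat -> V) :=
  exists d, forall l, mpoly_pow_dvd 0 ((p ^ d)%:R *: u l).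
Definition null_seq (u : nat -> V) :=
  forall k, exists l0, forall l, (l0 <= l)%N -> mpoly_pow_dvd k (u l).

Lemma bounded_subspace : subspace (K := K) bounded_seq.
Proof.
split; first by exists 0%N => l; rewrite scaler0; apply: mpoly_pow_dvd0.
move=> c u w [d hd] [d' hd']; have [e he] := pow_dvd_bounded v c.
exists (e + d + d')%N => l.
have -> : (p ^ (e + d + d'))%:R *: (c *: u + w) l =
   ((p ^ d')%:R * ((p ^ e)%:R * c)) *: ((p ^ d)%:R *: u l)
   + (p ^ (e + d))%:R *: ((p ^ d')%:R *: w l).
  rewrite !expnD !natrM scalerDr !scalerA; congr (_ *: _ + _ *: _); ring.
apply: mpoly_pow_dvdD; apply: (@mpoly_pow_dvdZ _ _ _ _ _ 0 0) => //;
  last exact: pow_dvd_nat.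
by apply: pow_dvdMl => //; apply: pow_dvd_nat.
Qed.

Lemma null_subspace : subspace (K := K) null_seq.
Proof.
split; first by move=> k; exists 0%N => l _; apply: mpoly_pow_dvd0.
move=> c u w hu hw k; have [d hd] := pow_dvd_bounded v c.
have [l1 h1] := hu (k + d)%N; have [l2 h2] := hw k.
exists (maxn l1 l2) => l; rewrite geq_max => /andP[/h1 h /h2 h'].
apply: mpoly_pow_dvdD h'; apply: (@mpoly_pow_dvd_div _ _ _ _ _ k d).
by rewrite scalerA; apply: (mpoly_pow_dvdZ hd h).
Qed.

Definition comp_action (a : Wc) (u : nat -> V) : nat -> V :=
  fun l => weyl_action b (qrepr a l) (u l).

Lemma comp_action_linear a c u w :
  comp_action a (c *: u + w) = c *: comp_action a u + comp_action a w.
Proof. by apply/funext => l; apply: weyl_action_linear. Qed.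

Lemma comp_action_bounded a u : bounded_seq u -> bounded_seq (comp_action a u).
Proof.
by move=> [d hd]; exists d => l; rewrite -weyl_actionZ; apply: mpoly_pow_dvd_weyl_action.
Qed.

Lemma comp_action_null a u : null_seq u -> null_seq (comp_action a u).
Proof.
move=> hu k; have [l0 h] := hu k; exists l0 => l /h; exact: mpoly_pow_dvd_weyl_action.
Qed.

(** Boundedness of [u] turns congruence modulo [p ^ l] at index [l] into
    convergence to [0]; so the choice of representatives in the inverse limit is
    immaterial. *)
Lemma idl_null (x y : nat -> W) u :
  (forall l, idl pX l (x l - y l)) ->
  bounded_seq u ->
  null_seq ((fun l => weyl_action b (x l) (u l)) - (fun l => weyl_action b (y l) (u l))).
Proof.
move=> xy [d hd] k; exists (k + d)%N => l kl.
have -> : ((fun l => weyl_action b (x l) (u l)) - (fun l => weyl_action b (y l) (u l))) l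
   = weyl_action b (x l - y l) (u l) by rewrite weyl_actionB.
apply: (@mpoly_pow_dvd_div _ _ _ _ _ k d); apply: mpoly_pow_dvd_le kl _.
by have := mpoly_pow_dvd_ideal b (xy l) (hd l); rewrite addn0 weyl_actionZ.
Qed.

Local Notation act := (term_action (idfun : {rmorphism K -> K}) comp_action).

Lemma qrepr_cls_idl (f : Defs.family pX) l :
  idl pX l (qrepr (cls (S := Wc) f) l - f l).
Proof. by have /cls_eq := qreprK (cls (S := Wc) f); apply. Qed.

Lemma base_change_rel_action s t u : rel s t -> bounded_seq u ->
  null_seq (act s u - act t u).
Proof.
move=> st hu; case: st => [x y|x y|r] /=.
- have -> : comp_action x u + comp_action y u =
     fun l => weyl_action b ((qrepr x : Defs.family _) l + (qrepr y : Defs.family _) l)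
       (u l).
    by apply/funext => l; rewrite weyl_actionD.
  by apply: idl_null hu => l; have := qrepr_cls_idl (family_add (qrepr x) (qrepr y)) l.
- have -> : comp_action x (comp_action y u) =
     fun l => weyl_action b ((qrepr x : Defs.family _) l * (qrepr y : Defs.family _) l)
       (u l).
    by apply/funext => l; rewrite weyl_actionM.
  by apply: idl_null hu => l; have := qrepr_cls_idl (family_mul (qrepr x) (qrepr y)) l.
- have -> : valring_val r *: u = fun l => weyl_action b (r *: (1 : W)) (u l).
    by apply/funext => l; rewrite weyl_action_cst.
  have -> : r *: (1 : Wc) = cls (S := Wc)
      (family_mul (family_cst pX r) (family_cst pX 1)) by exact: q_mulE.
  apply: idl_null hu => l.
  have := qrepr_cls_idl (family_mul (family_cst pX r) (family_cst pX 1)) l.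
  by rewrite /= scale1r mulr1.
Qed.

Definition compK_action (z : WK) (u : nat -> V) := act (qrepr z) u.

Definition seq_eq (u w : nat -> V) := null_seq (u - w).

Lemma compK_action_cls t u : bounded_seq u ->
  seq_eq (compK_action (cls (S := WK) t) u) (act t u).
Proof.
move=> hu; have /cls_eq e := qreprK (cls (S := WK) t).
apply: (term_action_cong comp_action_linear bounded_subspace null_subspace
  comp_action_bounded comp_action_null base_change_rel_action) hu.
exact: e.
Qed.

Definition acts_by (z : WK) (P : V) :=
  forall u, bounded_seq u -> seq_eq (compK_action z u) (fun l => P * u l).

Lemma seq_eq_trans u w x : seq_eq u w -> seq_eq w x -> seq_eq u x.
Proof.
move=> uw wx; have := subspaceD null_subspace uw wx.
by rewrite /seq_eq addrA subrK.
Qed.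

Lemma compK_action_null z u w : seq_eq u w ->
  seq_eq (compK_action z u) (compK_action z w).
Proof.
move=> uw; rewrite /seq_eq -(term_actionB _ comp_action_linear).
apply: (@term_action_stable _ _ _ _ _ comp_action null_seq) => //.
  exact: null_subspace.
exact: comp_action_null.
Qed.

Lemma acts_byD z w P Q : acts_by z P -> acts_by w Q -> acts_by (z + w) (P + Q).
Proof.
move=> hz hw u hu; apply: seq_eq_trans (compK_action_cls _ hu) _ => /=.
have -> : (fun l => (P + Q) * u l) = (fun l => P * u l) + (fun l => Q * u l).
  by apply/funext => l; rewrite mulrDl.
by rewrite /seq_eq opprD addrACA; apply: subspaceD null_subspace (hz _ hu) (hw _ hu).
Qed.

Lemma bounded_mull Q u : bounded_seq u -> bounded_seq (fun l => Q * u l).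
Proof.
move=> [d hd]; have [e he] := mpoly_bounded v Q; exists (e + d)%N => l.
by rewrite expnD natrM -scalerA scalerAr scalerAl; apply: mpoly_pow_dvdM he (hd l).
Qed.

Lemma acts_byM z w P Q : acts_by z P -> acts_by w Q -> acts_by (z * w) (P * Q).
Proof.
move=> hz hw u hu; apply: seq_eq_trans (compK_action_cls _ hu) _ => /=.
apply: seq_eq_trans (compK_action_null z (hw _ hu)) _.
apply: seq_eq_trans (hz _ (bounded_mull Q hu)) _.
rewrite /seq_eq; have -> : (fun l => P * Q * u l) = (fun l => P * (Q * u l)).
  by apply/funext => l; rewrite mulrA.
by rewrite subrr; case: null_subspace.
Qed.

Lemma acts_by_cst c : acts_by (q_cst WK c) c%:MP.
Proof.
move=> u hu; apply: seq_eq_trans (compK_action_cls _ hu) _ => /=.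
rewrite /seq_eq; have -> : (fun l => c%:MP * u l) = c *: u.
  by apply/funext => l; rewrite mul_mpolyC.
by rewrite subrr; case: null_subspace.
Qed.

Lemma acts_byZ c z P : acts_by z P -> acts_by (c *: z) (c *: P).
Proof. by rewrite -mul_mpolyC => hz; apply: acts_byM (acts_by_cst c) hz. Qed.

Lemma acts_by0 : acts_by 0 0.
Proof. by have := acts_by_cst 0; rewrite mpolyC0. Qed.

Lemma acts_by_sum I (s : seq I) (z : I -> WK) (P : I -> V) :
  (forall i, acts_by (z i) (P i)) ->
  acts_by (\sum_(i <- s) z i) (\sum_(i <- s) P i).
Proof.
move=> h; elim: s => [|i s IH]; first by rewrite !big_nil; apply: acts_by0.
by rewrite !big_cons; apply: acts_byD.
Qed.

Lemma acts_byX z P i : acts_by z P -> acts_by (z ^+ i) (P ^+ i).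
Proof.
move=> h; elim: i => [|i IH]; last by rewrite !exprS; apply: acts_byM.
by have := acts_by_cst 1; rewrite mpolyC1.
Qed.

Lemma acts_by_gen i :
  acts_by (to_completion_K (pgen (@weyl_rel _ _ _ v n) (mul_gen b i))) 'X_i.
Proof.
move=> u hu; apply: seq_eq_trans (compK_action_cls _ hu) _ => /=.
have -> : (fun l => 'X_i * u l) =
   (fun l => weyl_action b (pgen (@weyl_rel _ _ _ v n) (mul_gen b i)) (u l)).
  by apply/funext => l; rewrite weyl_action_gen.
apply: (@idl_null _ (fun _ => pgen (@weyl_rel _ _ _ v n) (mul_gen b i))) hu => l.
exact: qrepr_cls_idl.
Qed.

(** The element [p ^ - k z] is the class of an integral one, so it maps the
    constant sequence [1], up to a null sequence, to integral polynomials. *)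
Lemma acts_by_ball k z P : acts_by z P -> padic_ball k z -> mpoly_pow_dvd k P.
Proof.
move=> hz [a ea]; have h1 : bounded_seq (fun=> 1).
  by exists 0%N => l; rewrite scale1r; apply: mpoly_pow_dvd1.
have ha := acts_byZ (p ^ k)%:R^-1 hz.
rewrite ea scalerA mulVf ?pX_neq0 // scale1r in ha.
have [l0 hl] := subspaceD null_subspace
  (subspaceN null_subspace (ha _ h1)) (compK_action_cls (Gen a) h1) 0.
have {hl} := hl _ (leqnn l0); set Q := _ *: P in ha *; move=> hQ.
have {}hQ : mpoly_pow_dvd 0 (Q - comp_action a (fun=> 1) l0).
  have -> : Q - comp_action a (fun=> 1) l0 =
     (- (compK_action (to_base_change (@valring_val _ _ _ v) a) (fun=> 1)
         - (fun l => Q * 1))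
      + (compK_action (to_base_change (@valring_val _ _ _ v) a) (fun=> 1)
         - comp_action a (fun=> 1))) l0.
    by rewrite opprB addrA subrK /= -[in LHS](mulr1 Q).
  exact: hQ.
have {}hQ : mpoly_pow_dvd 0 Q.
  rewrite -[Q](subrK (comp_action a (fun=> 1) l0)); apply: mpoly_pow_dvdD hQ _.
  by apply: mpoly_pow_dvd_weyl_action; apply: mpoly_pow_dvd1.
have := mpoly_pow_dvdZ (pow_dvd_pX v k) hQ.
by rewrite addn0 /Q scalerA mulfV ?pX_neq0 // scale1r.
Qed.

End CompletedWeylAction.

(** * Scalar extension, unit balls and limits *)

Section ScalarExtension.
Variables (p : nat) (pp : prime p) (K : fieldExtType (Qp pp)) (v : valuation K).
Local Notation R := (valring v).
Variable A : setoid_alg R.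
Local Notation rel := (@base_change_rel R K (@valring_val _ _ _ v) A).
Local Notation AK := (base_change (@valring_val _ _ _ v) A).
Local Notation tbc := (@to_base_change R K (@valring_val _ _ _ v) A).

Lemma to_base_changeD a b : tbc (a + b) = tbc a + tbc b.
Proof. by rewrite [RHS]q_addE; apply/cls_eq/cong_rel; constructor. Qed.

Lemma to_base_changeM a b : tbc (a * b) = tbc a * tbc b.
Proof. by rewrite [RHS]q_mulE; apply/cls_eq/cong_rel; constructor. Qed.

Lemma to_base_change_cst r : tbc (r *: (1 : A)) = q_cst AK (valK r).
Proof. by apply/cls_eq/cong_rel; constructor. Qed.

Lemma to_base_changeZ r a : tbc (r *: a) = valK r *: tbc a.
Proof. by rewrite -[a in LHS]mul1r q_scaleAl to_base_changeM to_base_change_cst. Qed.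

Lemma to_base_change0 : tbc 0 = 0.
Proof. by apply: (addIr (tbc 0)); rewrite -to_base_changeD !add0r. Qed.

Lemma to_base_changeN a : tbc (- a) = - tbc a.
Proof. by apply/eqP; rewrite -addr_eq0 -to_base_changeD addNr to_base_change0. Qed.

Lemma to_base_changeB a b : tbc (a - b) = tbc a - tbc b.
Proof. by rewrite to_base_changeD to_base_changeN. Qed.

Lemma to_base_change_pX d a : (p ^ d)%:R *: tbc a = tbc ((p ^ d)%:R *: a).
Proof. by rewrite to_base_changeZ rmorph_nat. Qed.

(** The generators are integral, scalars become so after multiplication by a power
    of [p], and finitely many denominators have a common multiple. *)
Lemma to_base_change_denominator (z : AK) : exists d a, (p ^ d)%:R *: z = tbc a.
Proof.
have [t ->] := cls_surj z; elim: t => [a|c|s [d [a ea]] t [e [b eb]]|s [d [a ea]] t [e [b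
  eb]]].
- by exists 0%N, a; rewrite scale1r.
- have [d [r er]] := pow_dvd_bounded v c; exists d, (r *: (1 : A)).
  rewrite mul1r in er.
  by rewrite to_base_change_cst -er [LHS]q_mulE; apply/cls_eq/cong_sym/cong_cstM.
- exists (d + e)%N, ((p ^ e)%:R *: a + (p ^ d)%:R *: b).
  have -> : cls (S := AK) (Add s t) = cls (S := AK) s + cls (S := AK) t.
    by symmetry; exact: q_addE.
  rewrite to_base_changeD -!to_base_change_pX -ea -eb !scalerA -!natrM -!expnD.
  by rewrite scalerDr [(e + d)%N]addnC.
- exists (d + e)%N, (a * b).
  have -> : cls (S := AK) (Mul s t) = cls (S := AK) s * cls (S := AK) t.
    by symmetry; exact: q_mulE.
  by rewrite to_base_changeM -ea -eb -q_scaleAl -q_scaleAr scalerA -natrM -expnD.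
Qed.

End ScalarExtension.

Section Balls.
Variables (p : nat) (pp : prime p) (K : fieldExtType (Qp pp)) (v : valuation K).
Local Notation R := (valring v).
Variable A : setoid_alg R.
Local Notation AK := (completion_K A).

Lemma padic_ball0 k : padic_ball k (0 : AK).
Proof. by exists 0; rewrite to_base_change0 scaler0. Qed.

Lemma padic_ballD k (z w : AK) : padic_ball k z -> padic_ball k w -> padic_ball k (z + w).
Proof.
by move=> [a ->] [b ->]; exists (a + b); rewrite to_base_changeD scalerDr.
Qed.

Lemma padic_ballZ k (r : R) (z : AK) : padic_ball k z -> padic_ball k (valK r *: z).
Proof.
move=> [a ->]; exists (r *: a).
by rewrite to_base_changeZ !scalerA mulrC.
Qed.

End Balls.

Section Limits.
Variables (R : comPzRingType) (A : setoid_alg R) (I : Type) (X : I -> set A).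

Lemma to_limitD a b : to_limit X (a + b) = to_limit X a + to_limit X b.
Proof. by rewrite [RHS]q_addE; apply/cls_eq => i; apply: idl_eq. Qed.

Lemma to_limitZ r a : to_limit X (r *: a) = r *: to_limit X a.
Proof.
rewrite [RHS]q_mulE; apply/cls_eq => i; apply: idl_eq.
by rewrite /= -q_scaleAl mul1r.
Qed.

Lemma to_limit0 : to_limit X 0 = 0.
Proof. by apply: (addIr (to_limit X 0)); rewrite -to_limitD !add0r. Qed.

End Limits.

(** * The groups of unipotent block matrices *)

Section UnipotentBlocks.
Variables (p : nat) (pp : prime p) (n : nat) (b : bool).
Local Notation Zp := (Defs.Zp pp).
Local Notation M := 'M[Zp]_(n + n).

(** The case [true] is that of [B], the case [false] that of [C]. *)
Definition block_alg : set M := if b then @sp_b p pp n else @sp_c p pp n.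

Definition emb (Y : 'M[Zp]_n) : M :=
  if b then block_mx 0 Y 0 0 else block_mx 0 0 Y 0.

Definition coord (g : M) : 'M[Zp]_n := if b then ursubmx g else dlsubmx g.

Lemma block_algP X : block_alg X <-> exists2 Y, Y^T = Y & X = emb Y.
Proof. by rewrite /block_alg /emb; case: b. Qed.

Lemma emb_mul Y Z : emb Y *m emb Z = 0.
Proof.
by rewrite /emb; case: b; rewrite mulmx_block !mul0mx !mulmx0 !addr0 -block_mx0.
Qed.

Lemma embD Y Z : emb (Y + Z) = emb Y + emb Z.
Proof. by rewrite /emb; case: b; rewrite add_block_mx !addr0. Qed.

Lemma embZ c Y : emb (c *: Y) = c *: emb Y.
Proof. by rewrite /emb; case: b; rewrite scale_block_mx !scaler0. Qed.

Lemma coord_emb Y : coord (1%:M + emb Y) = Y.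
Proof.
by rewrite /coord /emb; case: b;
  rewrite scalar_mx_block add_block_mx ?block_mxKur ?block_mxKdl add0r.
Qed.

Lemma unipotentM Y Z : (1%:M + emb Y) *m (1%:M + emb Z) = 1%:M + emb (Y + Z).
Proof.
by rewrite mulmxDl !mulmxDr !mul1mx mulmx1 emb_mul addr0 embD addrA addrAC.
Qed.

Lemma zp_separated (x : Zp) : (forall k, exists y, x = (p ^ k)%:R * y) -> x = 0.
Proof.
move=> h; apply: zp_eqP => k; have [y ->] := h k.
by rewrite /= zres_nat modzz mul0r !mod0z.
Qed.

(** The exponential series of a matrix of square zero stops after two terms. *)
Lemma exp_square_zero m (x : 'M[Zp]_m) N : x *m x = 0 ->
  \sum_(i < N.+2) ((i`!)%:R : Qp pp)^-1 *: mx_Qp x ^+ i = mx_Qp (1%:M + x).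
Proof.
move=> xx; rewrite !big_ord_recl big1 => [|i _].
  rewrite /= expr0 expr1 /bump /= !fact0 invr1 !scale1r addr0.
  by rewrite /mx_Qp map_mxD map_mx1.
have x2 : mx_Qp x ^+ 2 = 0.
  by rewrite expr2 -[_ * _]/(mx_Qp x *m mx_Qp x) /mx_Qp -map_mxM xx map_mx0.
by rewrite !lift0 -addn2 exprD x2 mulr0 scaler0.
Qed.

Lemma is_expm_square_zero m (x g : 'M[Zp]_m) : x *m x = 0 ->
  is_expm x g <-> g = 1%:M + x.
Proof.
move=> xx; split=> [h|-> k]; last first.
  exists 2%N => -[//|[//|N]] _; exists 0.
  by rewrite exp_square_zero // subrr /mx_Qp map_mx0 scaler0.
apply/matrixP => i j; apply/eqP; rewrite eq_sym -subr_eq0; apply/eqP.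
apply: zp_separated => k; have [N0 /(_ N0.+2)[|a]] := h k.
  by rewrite -addn2 leq_addr.
rewrite exp_square_zero // => /matrixP/(_ i j) e; exists (a i j).
by move: e; rewrite !mxE -rmorphB -(rmorph_nat (@tofrac Zp)) -rmorphM => /eqP;
  rewrite tofrac_eq => /eqP <-.
Qed.

Lemma exp_groupP g : exp_group block_alg g <->
  exists2 Y, Y^T = Y & g = 1%:M + emb (p%:R *: Y).
Proof.
have sq Y : (p%:R *: emb Y) *m (p%:R *: emb Y) = 0 by rewrite -embZ emb_mul.
split=> [[x /block_algP[Y ys ->]]|[Y ys ->]].
  by move=> /(is_expm_square_zero _ (sq Y)); rewrite -embZ; exists Y.
exists (emb Y); first by apply/block_algP; exists Y.
by apply/(is_expm_square_zero _ (sq Y)); rewrite embZ.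
Qed.

End UnipotentBlocks.

(** * Masses of cosets *)

Section GroupAlgebra.
Variables (p : nat) (pp : prime p) (K : fieldExtType (Qp pp)) (v : valuation K).
Variables (n : nat) (b : bool).
Local Notation Zp := (Defs.Zp pp).
Local Notation R := (valring v).
Local Notation S := (exp_group (@block_alg p pp n b)).
Local Notation G := {g | S g}.
Local Notation RG := (group_alg v S).
Local Notation emb := (@emb p pp n b).
Local Notation coord := (@coord p pp n b).

Lemma group_coordK g : S g -> g = 1%:M + emb (coord g).
Proof. by move=> /exp_groupP[Y _ ->]; rewrite coord_emb. Qed.

Lemma coord_sym g : S g -> (coord g)^T = coord g.
Proof. by move=> /exp_groupP[Y ys ->]; rewrite coord_emb linearZ /= ys. Qed.

Lemma coordM g h : S g -> S h -> coord (g *m h) = coord g + coord h.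
Proof.
by move=> /group_coordK -> /group_coordK ->; rewrite unipotentM !coord_emb.
Qed.

Lemma coord1 : coord 1%:M = 0.
Proof.
have -> : 1%:M = 1%:M + emb 0 by rewrite -(scale0r (0 : 'M_n)) embZ scale0r addr0.
exact: coord_emb.
Qed.

Lemma coord_addZ g c a : coord (g + c *: a) = coord g + c *: coord a.
Proof. by rewrite /coord; case: b; apply/matrixP => i j; rewrite !mxE. Qed.

Lemma exp_group1 : S 1%:M.
Proof.
apply/exp_groupP; exists 0; first by rewrite trmx0.
by rewrite scaler0 -(scale0r (0 : 'M_n)) embZ scale0r addr0.
Qed.

Lemma exp_groupM g h : S g -> S h -> S (g *m h).
Proof.
move=> /exp_groupP[Y ys ->] /exp_groupP[Z zs ->]; apply/exp_groupP.
by exists (Y + Z); [rewrite linearD /= ys zs|rewrite unipotentM scalerDr].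
Qed.

Lemma exp_group_div g h : S g -> S h -> S (1%:M + emb (coord g - coord h)).
Proof.
move=> /exp_groupP[Y ys ->] /exp_groupP[Z zs ->]; apply/exp_groupP.
by exists (Y - Z); [rewrite linearB /= ys zs|rewrite !coord_emb scalerBr].
Qed.

Lemma exp_groupC g h : S g -> S h -> g *m h = h *m g.
Proof.
by move=> /group_coordK -> /group_coordK ->; rewrite !unipotentM [X in emb X]addrC.
Qed.

Local Notation V := ('M[Zp]_n -> K^o).

(** Group elements act on functions of the coordinates by translation.  Applied to
    the indicator function of a coset and evaluated at [0], an element of the group
    algebra gives the mass of that coset. *)
Definition shift_gen (g : G) (u : V) : V := fun Y => u (Y + coord (sval g)).

Lemma shift_gen_linear g c (u w : V) :
  shift_gen g (c *: u + w) = c *: shift_gen g u + shift_gen g w.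
Proof. by apply/funext => Y. Qed.

Lemma group_rel_action s t (u : V) : @group_rel p pp K v _ S s t ->
  term_action (@valK p pp K v) shift_gen s u = term_action (@valK p pp K v) shift_gen t u.
Proof.
case=> [[g gS] /= e|[g gS] [h hS] [k kS] /= e]; apply/funext => Y.
  by rewrite /shift_gen /= e coord1 addr0 ?rmorph1 scale1r.
by rewrite /shift_gen /= e coordM // addrA.
Qed.

Definition shift_action (x : RG) (u : V) : V :=
  presented_action (@valK p pp K v) shift_gen x u.

Lemma shift_actionD x y u : shift_action (x + y) u = shift_action x u + shift_action y u.
Proof. exact: (presented_actionD shift_gen_linear group_rel_action). Qed.

Lemma shift_actionB x y u : shift_action (x - y) u = shift_action x u - shift_action y u.
Proof. exact: (presented_actionB shift_gen_linear group_rel_action). Qed.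

Lemma shift_actionM x y u : shift_action (x * y) u = shift_action x (shift_action y u).
Proof. exact: (presented_actionM shift_gen_linear group_rel_action). Qed.

Lemma shift_action0 u : shift_action 0 u = 0.
Proof. exact: (presented_action0 shift_gen_linear group_rel_action). Qed.

Lemma shift_action_comb (l : seq (R * G)) u Y :
  shift_action (\sum_(x <- l) x.1 *: group_in v x.2) u Y =
  \sum_(x <- l) valK x.1 * u (Y + coord (sval x.2)).
Proof.
elim: l => [|x l IH]; first by rewrite !big_nil shift_action0.
rewrite !big_cons shift_actionD -IH; congr (_ + _).
rewrite /shift_action (presented_action_scale shift_gen_linear group_rel_action).
by rewrite (presented_action_gen shift_gen_linear group_rel_action).
Qed.

Lemma group_algM g h : exists k, group_in v g * group_in v h = group_in v k :> RG.
Proof.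
exists (exist _ _ (exp_groupM (svalP g) (svalP h))).
rewrite [LHS]q_mulE; apply/cls_eq/cong_sym/cong_rel; exact: group_mul.
Qed.

Lemma group_alg_span (x : RG) : exists l : seq (R * G),
  x = \sum_(y <- l) y.1 *: group_in v y.2.
Proof.
have [t ->] := cls_surj x; elim: t => [g|r|s [l el] t [m em]|s [l el] t [m em]] {x}.
- by exists [:: (1, g)]; rewrite big_seq1 scale1r.
- exists [:: (r, exist _ _ exp_group1)]; rewrite big_seq1 /=.
  have -> : group_in v (exist S _ exp_group1) = 1 :> RG.
    by apply/cls_eq/cong_rel; exact: group_1.
  rewrite [RHS]q_mulE; apply/cls_eq.
  by apply: cong_trans (cong_sym (cong_mul1 _ _)) _; apply: cong_cstC.
- exists (l ++ m); rewrite big_cat /= -el -em; symmetry; exact: q_addE.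
have -> : cls (S := RG) (Mul s t) = cls (S := RG) s * cls (S := RG) t.
  by symmetry; exact: q_mulE.
rewrite el em; elim: l {el} => [|x l [m' IH]].
  by exists [::]; rewrite !big_nil mul0r.
have [m2 em2] : exists m2 : seq (R * G),
    x.1 *: group_in v x.2 * \sum_(y <- m) y.1 *: group_in v y.2 =
    \sum_(y <- m2) y.1 *: group_in v y.2 :> RG.
  elim: m {em IH} => [|y m [m2 IH]]; first by exists [::]; rewrite !big_nil mulr0.
  have [k ek] := group_algM x.2 y.2; exists ((x.1 * y.1, k) :: m2).
  by rewrite !big_cons mulrDr IH -q_scaleAl -q_scaleAr ek scalerA.
by exists (m2 ++ m'); rewrite big_cons mulrDl IH em2 big_cat.
Qed.

Definition congruence_subgroup m : set 'M[Zp]_(n + n) :=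
  fun g => S g /\ exists a, g = 1%:M + (p ^ m)%:R *: a.

Lemma congruence_coord m g : S g ->
  (exists a, coord g = (p ^ m)%:R *: a) <-> (exists a, g = 1%:M + (p ^ m)%:R *: a).
Proof.
move=> gS; split=> -[a e].
  by exists (emb a); rewrite {1}(group_coordK gS) e embZ.
by exists (coord a); rewrite e coord_addZ coord1 add0r.
Qed.

Lemma congruence_open_normal m : open_normal S (congruence_subgroup m).
Proof.
split=> [g []//||g h [gS [a ea]] [hS [c ec]]|g h [gS [a ea]] hS gh|g h k gS hS gh [kS ek]|].
- by split; [exact: exp_group1|exists 0; rewrite scaler0 addr0].
- split; first exact: exp_groupM.
  exists (a + c + (p ^ m)%:R *: (a *m c)).
  rewrite ea ec mulmxDl !mulmxDr !mul1mx mulmx1 -scalemxAl -scalemxAr !scalerDr.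
  by rewrite !addrA [_ + _ *: c + _ *: a]addrAC.
- split=> //; apply/(congruence_coord m hS).
  have [|a' ea'] := (congruence_coord m gS).2; first by exists a.
  exists (- a'); apply/eqP; rewrite scalerN -addr_eq0 -ea' addrC -coordM //.
  by rewrite gh coord1.
- have -> : g *m k *m h = k by rewrite -mulmxA (exp_groupC kS hS) mulmxA gh mul1mx.
  by split.
- by exists m => g gS h; split.
Qed.

Definition congruence_index m : {M | open_normal S M} :=
  exist _ _ (congruence_open_normal m).

Local Notation idG m := (idl (@augmentation p pp K v _ S) (congruence_index m)).

(** The action on periodic functions factors through the quotient of the group
    algebra by the ideal of the congruence subgroup. *)
Lemma periodic_ideal m x (u : V) : idG m x ->
  (forall Y a, u (Y + (p ^ m)%:R *: a) = u Y) -> shift_action x u = 0.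
Proof.
move=> ix; elim: ix u => {x} [|_ [g [gS ga] ->]|x y _ IH _ IH'|a x _ IH|a x _ IH] u hu.
- exact: shift_action0.
- rewrite shift_actionB; apply/funext => Y.
  have -> : shift_action (group_in v g) u = shift_gen g u.
    exact: (presented_action_gen shift_gen_linear group_rel_action).
  have -> : shift_action 1 u = u.
    rewrite -[1 : RG]scale1r /shift_action.
    by rewrite (presented_action_cst shift_gen_linear group_rel_action) rmorph1 scale1r.
  have [c ec] := (congruence_coord m gS).2 ga.
  by rewrite /shift_gen /= fctE ec hu subrr.
- by rewrite shift_actionD IH // IH' // addr0.
- rewrite shift_actionM IH //.
  have := presented_actionZ (@valK p pp K v) shift_gen_linear (a : RG) 0 0.
  by rewrite !scale0r.
rewrite shift_actionM; apply: IH => Y c.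
pose P (w : V) := forall Z d, w (Z + (p ^ m)%:R *: d) = w Z.
suff : P (shift_action a u) by apply.
apply: (@term_action_stable _ _ _ _ _ shift_gen P) => //.
  by split=> [Z d|d w w' hw hw' Z e] //; rewrite !fctE hw hw'.
by move=> g w hw Z d; rewrite /shift_gen addrAC hw.
Qed.

Definition in_coset m (Y0 Y : 'M[Zp]_n) := exists a, Y - Y0 = (p ^ m)%:R *: a.

Lemma in_coset_refl m Y : in_coset m Y Y.
Proof. by exists 0; rewrite subrr scaler0. Qed.

Lemma in_coset_sym m Y Z : in_coset m Y Z -> in_coset m Z Y.
Proof. by move=> [a e]; exists (- a); rewrite scalerN -e opprB. Qed.

Lemma in_coset_trans m Y Z X : in_coset m Y Z -> in_coset m Z X -> in_coset m Y X.
Proof.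
by move=> [a e] [a' e']; exists (a' + a); rewrite scalerDr -e -e' addrA subrK.
Qed.

(** The indicator function of a coset is periodic, so the mass is well defined on
    the quotient ring. *)
Lemma coset_mass_congr m (l l' : seq (R * G)) :
  idG m (\sum_(x <- l) x.1 *: group_in v x.2 - \sum_(x <- l') x.1 *: group_in v x.2) ->
  forall Y0, \sum_(x <- l | `[< in_coset m Y0 (coord (sval x.2)) >]) valK x.1 =
             \sum_(x <- l' | `[< in_coset m Y0 (coord (sval x.2)) >]) valK x.1.
Proof.
move=> il Y0; pose u : V := fun Y => (`[< in_coset m Y0 Y >])%:R.
have hu Y a : u (Y + (p ^ m)%:R *: a) = u Y.
  rewrite /u; congr (_%:R); apply: congr1; apply: asbool_equiv_eq; split=> h.
    by apply: in_coset_trans h _; apply: in_coset_sym; exists a; rewrite addrC addKr.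
  by apply: in_coset_trans h _; exists a; rewrite addrC addKr.
have /(congr1 (fun w : V => w 0)) := periodic_ideal il hu.
rewrite shift_actionB !fctE !shift_action_comb => /eqP; rewrite subr_eq0 => /eqP.
move=> e; have mass (k : seq (R * G)) :
    \sum_(x <- k | `[< in_coset m Y0 (coord (sval x.2)) >]) valK x.1 =
    \sum_(x <- k) valK x.1 * u (0 + coord (sval x.2)).
  rewrite big_mkcond; apply: eq_bigr => x _; rewrite add0r /u.
  by case: asboolP => _; rewrite ?mulr1 ?mulr0.
by rewrite !mass.
Qed.

Lemma same_coset_ideal m g h : in_coset m (coord (sval h)) (coord (sval g)) ->
  idG m (group_in v g - group_in v h).
Proof.
case: g h => [g gS] [h hS] /= hc.
pose k : G := exist S _ (exp_group_div gS hS).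
have -> : group_in v (exist S g gS) = group_in v (exist S h hS) * group_in v k.
  rewrite [RHS]q_mulE; apply/cls_eq/cong_rel/group_mul => /=.
  by rewrite {1}(group_coordK gS) {1}(group_coordK hS) unipotentM addrCA subrr addr0.
rewrite -[X in _ - X]mulr1 -mulrBr; apply/ideal_mull/ideal_gen.
exists k => //; split; first exact: svalP.
by apply/(congruence_coord m (svalP k)); rewrite /= coord_emb.
Qed.

Lemma ideal_sum m I (s : seq I) (P : pred I) (F : I -> RG) :
  (forall i, P i -> idG m (F i)) -> idG m (\sum_(i <- s | P i) F i).
Proof. by move=> h; apply: big_ind => //; [exact: ideal0|exact: ideal_add]. Qed.

Lemma ideal_scale m (r : R) x : idG m x -> idG m (r *: x).
Proof. exact: ideal_mull. Qed.

(** The elements of a coset are congruent to each other modulo the ideal, so the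
    combination is congruent to one of coset representatives, whose coefficients
    are the masses.  The induction removes one coset at a time. *)
Lemma zero_masses_ideal m (l : seq (R * G)) :
  (forall g0 : G, \sum_(x <- l | `[< in_coset m (coord (sval g0)) (coord (sval x.2)) >])
     valK x.1 = 0) ->
  idG m (\sum_(x <- l) x.1 *: group_in v x.2).
Proof.
move: {2}(size l).+1 (ltnSn (size l)) => N; elim: N l => // N IH [|[c g] l] sl hl.
  by rewrite big_nil; apply: ideal0.
pose P (x : R * G) := `[< in_coset m (coord (sval g)) (coord (sval x.2)) >].
set l1 := _ :: l in sl hl *; rewrite (bigID P) /=; apply: ideal_add.
  have -> : \sum_(x <- l1 | P x) x.1 *: group_in v x.2 =
            \sum_(x <- l1 | P x) x.1 *: (group_in v x.2 - group_in v g).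
    have e0 : \sum_(x <- l1 | P x) x.1 = 0 :> R.
      by apply: val_inj; rewrite rmorph_sum; apply: hl.
    under [RHS]eq_bigr => x _ do rewrite scalerBr.
    by rewrite sumrB -[X in _ - X]scaler_suml e0 scale0r subr0.
  by apply: ideal_sum => x /asboolP hx; apply/ideal_scale/same_coset_ideal.
rewrite -big_filter; apply: IH => [|g0].
  rewrite ltnS in sl; apply: leq_trans _ sl; rewrite /= ltnS {1}/P.
  case: asboolP => [_|[]]; last exact: in_coset_refl.
  by rewrite size_filter count_size.
rewrite big_filter_cond; case: (pselect (in_coset m (coord (sval g0)) (coord (sval g))))
  => hg.
  rewrite big_pred0 // => x; apply/negbTE/negP => /andP[/negP + /asboolP h].
  by apply; apply/asboolP; apply: in_coset_trans (in_coset_sym hg) h.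
rewrite -[RHS](hl g0); apply: eq_bigl => x /=.
case: asboolP => h; last by rewrite andbF.
rewrite andbT; apply/negP => /asboolP h'; apply: hg.
exact: in_coset_trans h (in_coset_sym h').
Qed.

End GroupAlgebra.

(** * Moments as coefficients of exponentials *)

Section Evaluation.
Variables (p : nat) (pp : prime p) (K : fieldExtType (Qp pp)) (v : valuation K).
Variables (n : nat) (b : bool).
Local Notation Zp := (Defs.Zp pp).
Local Notation R := (valring v).
Local Notation V := {mpoly K[n]}.
Local Notation eK := (map_poly (@Zp_in p pp K)).
Local Notation rK := (map_poly (@valK p pp K v)).

Definition quad_form (y : 'M[Zp]_n) : V :=
  \sum_(i < n) \sum_(j < n) Zp_in K (y i j) *: ('X_i * 'X_j).

(** The factor with which the representation multiplies quadratic forms in the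
    [d_i], respectively the [x_i]. *)
Definition half_sign : K := if b then 2%:R^-1 else - 2%:R^-1.

Definition truncated_exp N (y : 'M[Zp]_n) : V :=
  \sum_(i < N) (i`!)%:R^-1 *: (half_sign *: quad_form y) ^+ i.

Definition bipoly_pow_dvd k (F : {poly {poly K}}) := forall i j, pow_dvd v k F`_i`_j.

Lemma bipoly_pow_dvdM k l F H : bipoly_pow_dvd k F -> bipoly_pow_dvd l H ->
  bipoly_pow_dvd (k + l) (F * H).
Proof.
move=> hF hH i j; rewrite coefM coef_sum; apply: pow_dvd_sum => a _.
by rewrite coefM; apply: pow_dvd_sum => c _; apply: pow_dvdM.
Qed.

Lemma bipoly_pow_dvd_sum k I (s : seq I) (P : pred I) (F : I -> {poly {poly K}}) :
  (forall i, P i -> bipoly_pow_dvd k (F i)) -> bipoly_pow_dvd k (\sum_(i <- s | P i) F i).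
Proof.
move=> h i j; rewrite !coef_sum; apply: pow_dvd_sum => a ha; exact: h.
Qed.

Lemma bipoly_pow_dvdC k c : pow_dvd v k c -> bipoly_pow_dvd k c%:P%:P.
Proof.
move=> h i j; rewrite coefC; case: eqP => _; last by rewrite coef0; apply: pow_dvd0.
by rewrite coefC; case: eqP => _ //; apply: pow_dvd0.
Qed.

(** The value [theta ^ (2 ^ i)], multiplied by a variable that marks the degree;
    it separates the terms of the exponential series. *)
Definition weighted_var (i : 'I_n) : {poly {poly K}} := ('X^(2 ^ i))%:P * 'X.

Definition weighted_eval : V -> {poly {poly K}} :=
  mmap (@polyC {poly K} \o @polyC K) weighted_var.

Lemma weighted_evalZ c u : weighted_eval (c *: u) = c%:P%:P * weighted_eval u.
Proof. exact: mmapZ. Qed.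

Lemma weighted_evalX u i : weighted_eval (u ^+ i) = weighted_eval u ^+ i.
Proof. exact: rmorphXn. Qed.

Lemma weighted_eval_sum I (s : seq I) (F : I -> V) :
  weighted_eval (\sum_(x <- s) F x) = \sum_(x <- s) weighted_eval (F x).
Proof. exact: rmorph_sum. Qed.

Lemma bipoly_pow_dvd_weighted_eval k u : mpoly_pow_dvd v k u ->
  bipoly_pow_dvd k (weighted_eval u).
Proof.
move=> hu; apply: bipoly_pow_dvd_sum => m _; rewrite -[k]addn0; apply: bipoly_pow_dvdM.
  exact: bipoly_pow_dvdC.
have b1 : bipoly_pow_dvd 0 1 by rewrite -(rmorph1 (@polyC {poly K} \o @polyC K));
  apply/bipoly_pow_dvdC/(pow_dvd_nat v 1).
apply: (big_ind (bipoly_pow_dvd 0)) => // [F H|i _]; first exact: bipoly_pow_dvdM.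
elim: (m i) => [|a IH]; first by rewrite expr0.
rewrite exprS; apply: (@bipoly_pow_dvdM 0 0) IH => c d.
rewrite coefCM coefX coefM; apply: pow_dvd_sum => e _.
rewrite coefXn; case: (c == 1)%N; rewrite ?coef1 ?coef0 -?natrM; try exact: pow_dvd_nat.
by rewrite mulr0; apply: pow_dvd0.
Qed.

Lemma weighted_eval_quad_form y :
  weighted_eval (quad_form y) = (eK (form_at_powers y))%:P * 'X^2.
Proof.
rewrite /weighted_eval /quad_form /form_at_powers !rmorph_sum mulr_suml /=.
apply: eq_bigr => i _; rewrite !rmorph_sum mulr_suml /=; apply: eq_bigr => j _.
rewrite mmapZ rmorphM /= !mmapX !mmap1U /weighted_var rmorphM /= map_polyXn map_polyC /=.
by rewrite exprD !rmorphM /=; ring.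
Qed.

Lemma weighted_eval_exp N y i : (i < N)%N ->
  (weighted_eval (truncated_exp N y))`_(2 * i) =
  ((i`!)%:R^-1 * half_sign ^+ i)%:P * eK (form_at_powers y) ^+ i.
Proof.
move=> iN; rewrite /truncated_exp weighted_eval_sum coef_sum.
have term j : weighted_eval ((j`!)%:R^-1 *: (half_sign *: quad_form y) ^+ j) =
  (((j`!)%:R^-1 * half_sign ^+ j)%:P * eK (form_at_powers y) ^+ j)%:P * 'X^(2 * j).
  rewrite weighted_evalZ weighted_evalX weighted_evalZ weighted_eval_quad_form.
  by rewrite !exprMn -exprD addnn -mul2n !polyCM !polyC_exp; ring.
rewrite (bigD1 (Ordinal iN)) //= [X in _ + X]big1 => [|j jN].
  by rewrite addr0 term coefCM coefXn eqxx mulr1.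
rewrite term coefCM coefXn; case: eqP => e; last by rewrite mulr0.
case/eqP: jN; apply: val_inj => /=; apply/eqP.
by rewrite -(eqn_pmul2l (isT : 0 < 2)%N) e.
Qed.

Lemma pow_dvd_poly k (f : {poly K}) : (forall i, pow_dvd v k f`_i) ->
  exists g, f = (p ^ k)%:R * rK g.
Proof.
move=> h; exists (\poly_(i < size f) projT1 (cid (h i))).
apply/polyP => i; rewrite mulr_natl coefMn -[RHS]mulr_natl coef_map coef_poly.
case: ltnP => hi; first by case: cid.
by rewrite nth_default // [X in _ * X](rmorph0 (@valK p pp K v)) mulr0.
Qed.

Lemma half_sign_neq0 : half_sign != 0.
Proof. by rewrite /half_sign; case: b; rewrite ?oppr_eq0 invr_eq0 natK_neq0. Qed.

(** The [i]-th moment is the coefficient of degree [2 i] in the marking variable,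
    divided by [half_sign ^ i / i!]; the inverse of that factor is an integer, so
    no precision is lost. *)
Lemma moments_of_exp k N (J : Type) (l : seq J) (c : J -> R) (y : J -> 'M[Zp]_n) :
  mpoly_pow_dvd v k (\sum_(x <- l) valK (c x) *: truncated_exp N (y x)) ->
  forall i, (i < N)%N -> exists g : {poly R},
   \sum_(x <- l) (valK (c x))%:P * eK (form_at_powers (y x)) ^+ i = (p ^ k)%:R * rK g.
Proof.
move=> /bipoly_pow_dvd_weighted_eval h i iN; apply: pow_dvd_poly => j.
have {h} := h (2 * i)%N j.
rewrite weighted_eval_sum coef_sum.
under eq_bigr => x _.
  rewrite weighted_evalZ coefCM (weighted_eval_exp _ iN) mulrCA.
  over.
rewrite -mulr_sumr coefCM => h.
have f0 : (i`!)%:R^-1 * half_sign ^+ i != 0 :> K.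
  by rewrite mulf_neq0 ?expf_neq0 ?half_sign_neq0 // invr_eq0 natK_neq0 // fact_gt0.
rewrite -[X in pow_dvd v k X](mulKf f0); apply: pow_dvdMl h.
rewrite invfM invrK -exprVn; apply: (@pow_dvdM _ _ _ _ 0 0); first exact: pow_dvd_nat.
elim: i {iN f0} => [|i IH]; first by rewrite expr0; apply: (pow_dvd_nat v 1).
rewrite exprS; apply: pow_dvdMl IH; rewrite /half_sign; case: b.
  by rewrite invrK; apply: pow_dvd_nat.
by rewrite invrN invrK; apply/pow_dvdN/pow_dvd_nat.
Qed.

End Evaluation.

(** * The metaplectic representation on the Iwasawa algebras *)

Section Metaplectic.
Variables (p : nat) (pp : prime p) (K : fieldExtType (Qp pp)) (v : valuation K).
Variables (n : nat) (b : bool).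
Local Notation Zp := (Defs.Zp pp).
Local Notation R := (valring v).
Local Notation S := (exp_group (@block_alg p pp n b)).
Local Notation G := {g | S g}.
Local Notation emb := (@emb p pp n b).
Local Notation coord := (@coord p pp n b).
Local Notation UK := (completion_K (enveloping v (@sp p pp n))).
Local Notation AK := (completion_K (weyl v n)).
Local Notation KS := (iwasawa_K v S).
Local Notation tbc := (to_base_change (@valring_val _ _ _ v)).
Local Notation comb l := (\sum_(x <- l) x.1 *: group_in v x.2).
Variables (rho : {rmorphism UK -> AK}) (rhoP : is_metaplectic rho).
Variables (iota : {rmorphism KS -> UK}) (iotaP : is_iwasawa_embedding iota).

Lemma quad_formZ c (y : 'M[Zp]_n) : quad_form K (c *: y) = Zp_in K c *: quad_form K y.
Proof.
rewrite /quad_form scaler_sumr; apply: eq_bigr => i _.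
by rewrite scaler_sumr; apply: eq_bigr => j _; rewrite mxE rmorphM scalerA.
Qed.

Lemma acts_by_quad (g : 'I_n -> AK) (y : 'M[Zp]_n) :
  (forall i, acts_by b (g i) 'X_i) ->
  acts_by b (\sum_(i < n) \sum_(j < n) Zp_in K (y i j) *: (g i * g j)) (quad_form K y).
Proof.
by move=> hg; do 2![apply: acts_by_sum => ?]; apply/acts_byZ/acts_byM.
Qed.

Lemma rho_acts (Y : 'M[Zp]_n) (X : {X | @sp p pp n X}) : sval X = emb Y ->
  acts_by b (rho (env_in v X)) (half_sign K b *: quad_form K Y).
Proof.
have z0 (g : 'I_n -> 'I_n -> AK) :
    \sum_(i < n) \sum_(j < n) Zp_in K ((0 : 'M[Zp]_n) i j) *: g i j = 0.
  by rewrite big1 // => i _; rewrite big1 // => j _; rewrite mxE rmorph0 scale0r.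
have := @acts_by_gen _ _ _ v n b; have := acts_by_quad.
rewrite /emb /half_sign /mul_gen; case: b => hq hg e.
  rewrite (@metaplecticE _ _ _ _ _ _ rhoP X 0 Y 0) ?trmx0 ?oppr0 // !z0.
  rewrite mxtrace0 rmorph0 mulr0 scale0r scaler0 oppr0 !add0r addr0.
  by apply/acts_byZ/hq => i; apply: hg.
rewrite (@metaplecticE _ _ _ _ _ _ rhoP X 0 0 Y) ?trmx0 ?oppr0 // !z0.
rewrite mxtrace0 rmorph0 mulr0 scale0r scaler0 oppr0 !add0r -scaleNr.
by apply/acts_byZ/hq => i; apply: hg.
Qed.

Lemma sub_sp Y : Y^T = Y -> @sp p pp n (emb Y).
Proof.
move=> ys; rewrite /sp /emb; case: b.
  by exists 0, Y, 0; rewrite ys !trmx0 oppr0.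
by exists 0, 0, Y; rewrite ys !trmx0 oppr0.
Qed.

(** The exponential series converges in the completed enveloping algebra; by
    continuity its image converges, and its partial sums act by polynomials. *)
Lemma rho_exp k (g : G) : exists N0, forall N, (N0 <= N)%N -> exists z,
  padic_ball k (z - rho (iota (iwasawa_in v g))) /\
  acts_by b z (truncated_exp K b N (coord (sval g))).
Proof.
case: g => g gS; have [Y ys eg] := (exp_groupP b g).1 gS.
pose X : {X | @sp p pp n X} := exist _ _ (sub_sp ys).
have gX : is_expm (p%:R *: sval X) g.
  apply/is_expm_square_zero; last by rewrite eg /= embZ.
  by rewrite /= -embZ emb_mul.
have sX : block_alg b (sval X) by apply/block_algP; exists Y.
have [l hl] := metaplectic_continuous rhoP k.
have [N0 hN] := iwasawa_exp iotaP sX (g := exist S g gS) gX l.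
exists N0 => N /hN /hl h; eexists; split; first exact: h.
rewrite rmorph_sum; apply: acts_by_sum => i.
rewrite (metaplectic_scalable rhoP) rmorphXn (metaplectic_scalable rhoP).
apply/acts_byZ/acts_byX; rewrite /= eg coord_emb quad_formZ rmorph_nat scalerA mulrC
  -scalerA.
exact/acts_byZ/rho_acts.
Qed.

Lemma rho_comb k (l : seq (R * G)) : exists N0, forall N, (N0 <= N)%N -> exists z,
  padic_ball k (z - rho (iota (tbc (to_limit (augmentation (S := S)) (comb l))))) /\
  acts_by b z (\sum_(x <- l) valK x.1 *: truncated_exp K b N (coord (sval x.2))).
Proof.
elim: l => [|x l [N1 IH]].
  exists 0%N => N _; exists 0; split; last by rewrite big_nil; apply: acts_by0.
  by rewrite big_nil to_limit0 to_base_change0 !rmorph0 subrr; apply: padic_ball0.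
have [N2 h2] := rho_exp k x.2; exists (maxn N1 N2) => N.
rewrite geq_max => /andP[/IH [z [bz az]] /h2 [w [bw aw]]].
exists (valK x.1 *: w + z); split; last first.
  by rewrite big_cons; apply: acts_byD az; apply: acts_byZ.
rewrite big_cons to_limitD to_limitZ to_base_changeD to_base_changeZ !rmorphD.
rewrite (iwasawa_scalable iotaP) (metaplectic_scalable rhoP).
rewrite opprD addrACA -scalerBr; apply: padic_ballD bz.
exact: padic_ballZ.
Qed.

Lemma subgroup_contains_congruence (M : {M | open_normal S M}) : exists m0, forall m,
  (m0 <= m)%N -> (congruence_subgroup b m `<=` sval M)%classic.
Proof.
have [m0 h] := on_open (svalP M); exists m0 => m hm g [gS [a ea]]; apply: h => //.
by exists ((p ^ (m - m0))%:R *: a); rewrite ea scalerA -natrM -expnD subnKC.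
Qed.

Lemma augmentation_mono (M M' : {M | open_normal S M}) : (sval M `<=` sval M')%classic ->
  (idl (@augmentation p pp K v _ S) M `<=` idl (@augmentation p pp K v _ S) M')%classic.
Proof.
move=> sM x; elim=> {x} [|_ [g gM ->]|x y _ hx _ hy|a x _ hx|a x _ hx].
- exact: ideal0.
- by apply: ideal_gen; exists g => //; apply: sM.
- exact: ideal_add.
- exact: ideal_mull.
- exact: ideal_mulr.
Qed.

Local Notation cong_index m := (@congruence_index p pp n b m).

(** The component [f M'] differs from the limit by an element that vanishes
    modulo [M'], and the images of such elements are small if [M'] is small. *)
Lemma approximation (f : Defs.family (@augmentation p pp K v _ S)) k m :
  rho (iota (tbc (cls (S := iwasawa_R v S) f))) = 0 ->
  exists2 m', (m <= m')%N & padic_ball k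
    (rho (iota (tbc (to_limit (augmentation (S := S)) (f (cong_index m')))))).
Proof.
move=> f0; have [l1 h1] := metaplectic_continuous rhoP k.
have [M [l2 h2]] := iwasawa_continuous iotaP l1.
have [m0 h0] := subgroup_contains_congruence M.
exists (maxn m m0); first exact: leq_maxl.
set nu := f _.
have sM : (idl (@augmentation p pp K v _ S) (cong_index (maxn m m0)) `<=`
           idl (@augmentation p pp K v _ S) M)%classic.
  by apply: augmentation_mono; apply: h0; apply: leq_maxr.
have hn : iwasawa_nbhs M l2 (to_limit (augmentation (S := S)) nu - cls (S := iwasawa_R v
  S) f).
  exists (family_add (family_diag _ nu) (family_mul (family_cst _ (-1)) f)); split.
    have -> : - cls (S := iwasawa_R v S) f =
      cls (S := iwasawa_R v S) (family_mul (family_cst _ (-1)) f) by exact: q_mulE.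
    exact: q_addE.
  exists 0; rewrite scaler0 subr0 /= -q_scaleAl mul1r scaleN1r -opprB.
  by apply/idlN/famP.
have := h2 _ hn; rewrite to_base_changeB rmorphB => /h1.
by rewrite f0 subr0.
Qed.

Lemma in_coset_dvt m (y z : 'M[Zp]_n) : odd p -> y^T = y -> z^T = z ->
  in_coset m z y <->
  theta_dvd (form_deg n) (form_deg n * m) (form_at_powers y - form_at_powers z).
Proof.
move=> p_odd ys zs; rewrite -form_at_powersB; split=> [[a ->]|].
  have -> : form_at_powers ((p ^ m)%:R *: a) = (p ^ m)%:R * form_at_powers a.
    rewrite /form_at_powers mulr_sumr; apply: eq_bigr => i _.
    by rewrite mulr_sumr; apply: eq_bigr => j _; rewrite mxE polyCM polyC_natr mulrA.
  exact: theta_dvd_pX.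
by move=> /(form_at_powers_dvd p_odd) h; apply: h; rewrite linearB /= ys zs.
Qed.

(** At each level [m] the masses are computed from an approximation that depends
    on the desired precision [k]; they do not depend on it by
    [coset_mass_congr], so they are divisible by every power of [p]. *)
Lemma rho_iota_kernel_limit (f : Defs.family (@augmentation p pp K v _ S)) : odd p ->
  rho (iota (tbc (cls (S := iwasawa_R v S) f))) = 0 ->
  cls (S := iwasawa_R v S) f = 0.
Proof.
move=> p_odd f0; apply/cls_eq => M /=; rewrite scale0r subr0.
have [m hm] := subgroup_contains_congruence M.
have sM : (idl (@augmentation p pp K v _ S) (cong_index m) `<=`
           idl (@augmentation p pp K v _ S) M)%classic.
  by apply: augmentation_mono; apply: hm.
rewrite -[f M](subrK (f (cong_index m))); apply: ideal_add; first exact: famP.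
apply: sM; have [l0 el0] := group_alg_span (f (cong_index m)).
rewrite el0; apply: zero_masses_ideal => g0; apply: (pow_dvd_separated (v := v)) => k.
have [I [d hd]] := moments_mass v (ltn0Sn _ : 0 < form_deg n)%N
  (form_deg n * m) k (form_at_powers (coord (sval g0))).
have [m' mm' hb] := approximation d m f0.
have [l el] := group_alg_span (f (cong_index m')).
have same : idl (@augmentation p pp K v _ S) (cong_index m) (comb l0 - comb l).
  rewrite -el0 -el; apply: famP; apply: augmentation_mono => g [gS [a ea]].
  split=> //; exists ((p ^ (m' - m))%:R *: a).
  by rewrite ea scalerA -natrM -expnD subnKC.
rewrite (coset_mass_congr same).
pose l' := [seq (x.1, form_at_powers (coord (sval x.2))) | x <- l].
have : pow_dvd v k (\sum_(x <- l' | `[< theta_dvd (form_deg n) (form_deg n * m)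
    (x.2 - form_at_powers (coord (sval g0))) >]) valK x.1).
  apply: hd => i iI; have [N0 hN] := rho_comb d l.
  have [z [bz az]] := hN _ (leq_maxl N0 I).
  rewrite -el in bz; have {}bz := padic_ballD bz hb; rewrite subrK in bz.
  have := moments_of_exp (acts_by_ball az bz) (leq_trans iI (leq_maxr N0 I)).
  by rewrite /l' big_map.
rewrite /l' big_map; congr (pow_dvd v k _); apply: eq_bigl => x /=.
apply: asbool_equiv_eq; apply: iff_sym; apply: in_coset_dvt => //.
  exact: coord_sym (svalP _).
exact: coord_sym (svalP _).
Qed.

(** It suffices to consider the classes of elements of [RS], since [p] is
    invertible in [K]. *)
Lemma rho_iota_injective : odd p -> injective (rho \o iota).
Proof.
move=> p_odd z w /= zw; apply/eqP; rewrite -subr_eq0; apply/eqP.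
have [d [a ea]] := to_base_change_denominator (z - w).
have [f ef] := cls_surj a.
have a0 : a = 0.
  rewrite ef; apply: rho_iota_kernel_limit => //; rewrite -ef -ea.
  rewrite (iwasawa_scalable iotaP) (metaplectic_scalable rhoP) !rmorphB zw subrr.
  by rewrite scaler0.
have := congr1 (fun u => (p ^ d)%:R^-1 *: u) ea.
by rewrite /= a0 to_base_change0 scaler0 scalerA mulVf ?pX_neq0 // scale1r.
Qed.

End Metaplectic.

Theorem corollary5p5 (p : nat) (pp : prime p) (p_odd : odd p)
    (K : fieldExtType (Qp pp)) (v : valuation K) (n : nat) (n_ge2 : (2 <= n)%N)
    (rho : {rmorphism completion_K (enveloping v (@sp p pp n)) ->
                      completion_K (weyl v n)})
    (rhoP : is_metaplectic rho)
    (iotaC : {rmorphism iwasawa_K v (exp_group (@sp_c p pp n)) ->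
                        completion_K (enveloping v (@sp p pp n))})
    (iotaCP : is_iwasawa_embedding iotaC)
    (iotaB : {rmorphism iwasawa_K v (exp_group (@sp_b p pp n)) ->
                        completion_K (enveloping v (@sp p pp n))})
    (iotaBP : is_iwasawa_embedding iotaB) :
  injective (rho \o iotaC) /\ injective (rho \o iotaB).
Proof.
split; first exact: (@rho_iota_injective _ _ _ _ _ false _ rhoP _ iotaCP p_odd).
exact: (@rho_iota_injective _ _ _ _ _ true _ rhoP _ iotaBP p_odd).
Qed.
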